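(* Let $R$ be a real affine algebra of Krull dimension $d\ge 2$ such that either $R$ has no real maximal ideals, or the intersection of all real maximal ideals of $R$ has height at least $1$. Then the group $\mathrm{WMS}_{d+1}(R)$ is divisible.
   Context: A real affine algebra is a finitely generated commutative $\mathbb R$-algebra; a maximal ideal $\mathfrak m$ is real if $R/\mathfrak m\cong\mathbb R$. For a commutative noetherian ring $A$, $\mathrm{Um}_{n}(A)$ is the set of unimodular rows of length $n$ and $\mathrm E_n(A)$ is the group generated by elementary matrices. A weak Mennicke symbol of length $n+1\ge 3$ is a pair $(\phi,G)$ with $G$ a group and $\phi:\mathrm{Um}_{n+1}(A)\to G$ such that (1) $\phi(1,0,\dots,0)=1$ and $\phi(v)=\phi(v\epsilon)$ for $\epsilon\in\mathrm E_{n+1}(A)$; (2) $\phi(a,a_1,\dots,a_n)\phi(1-a,a_1,\dots,a_n)=\phi(a(1-a),a_1,\dots,a_n)$ whenever $(a,a_1,\dots,a_n)$ and $(1-a,a_1,\dots,a_n)$ are unimodular. $\mathrm{WMS}_{n+1}(A)$ is the target group of the universal weak Mennicke symbol. If $A$ has dimension $n\ge2$, by Vaserstein and van der Kallen the orbit set $\mathrm{Um}_{n+1}(A)/\mathrm E_{n+1}(A)$ carries an abelian group structure which coincides with $\mathrm{WMS}_{n+1}(A)$. *)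

(* Defs.v *)
From HB Require Import structures.
From mathcomp Require Import all_boot all_order all_algebra.
From mathcomp Require Import all_classical all_reals ereal.
Set Implicit Arguments.
Unset Strict Implicit.
Unset Printing Implicit Defensive.
Import Order.TTheory GRing.Theory Num.Theory.
Local Open Scope classical_set_scope.
Local Open Scope ring_scope.

(* ssreflect's [idealr_closed S] requires [1 \notin S]: it is the notion of a
   proper ideal. *)
Definition proper_ideal_set (A : comNzRingType) (I : set A) : Prop :=
  idealr_closed (mem I).

Definition prime_ideal (A : comNzRingType) (p : set A) : Prop :=
  proper_ideal_set p /\ prime_idealr_closed (mem p).

Definition maximal_ideal (A : comNzRingType) (m : set A) : Prop :=
  proper_ideal_set m /\
  forall J : set A, proper_ideal_set J -> m `<=` J -> J = m.

Definition prime_chain (A : comNzRingType) (n : nat) (c : nat -> set A) : Prop :=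
  (forall i, (i <= n)%N -> prime_ideal (c i)) /\
  (forall i, (i < n)%N -> c i `<` c i.+1).

(* Dimensions and heights live in the extended reals over [K], which only
   serve as a complete order containing the naturals. *)
Definition krull_dim (K : realType) (A : comNzRingType) : \bar K :=
  ereal_sup [set (n%:R : K)%:E | n in
    [set n : nat | exists c : nat -> set A, prime_chain n c]].

Definition prime_height (K : realType) (A : comNzRingType) (p : set A) : \bar K :=
  ereal_sup [set (n%:R : K)%:E | n in
    [set n : nat | exists c : nat -> set A, prime_chain n c /\ c n = p]].

(* The unit ideal has height [+oo]. *)
Definition height (K : realType) (A : comNzRingType) (I : set A) : \bar K :=
  ereal_inf [set prime_height K p | p in
    [set p : set A | prime_ideal p /\ I `<=` p]].

Definition finitely_generated_algebra (K : comNzRingType) (A : comAlgType K) : Prop :=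
  exists s : seq A, forall S : {pred A},
    GRing.subalg_closed S -> {subset s <= S} -> forall a : A, a \in S.

(* A ring isomorphism with [K] is automatically [K]-linear, since a field of
   real numbers has no endomorphism but the identity. *)
Definition real_maximal_ideal (K : realType) (A : comAlgType K) (m : set A) : Prop :=
  maximal_ideal m /\
  exists I : idealr A, [set` I] = m /\
    exists f : {rmorphism {ideal_quot I} -> K}, bijective f.

Definition unimodular (A : comNzRingType) (n : nat) (v : 'rV[A]_n) : Prop :=
  exists w : 'cV[A]_n, v *m w = 1%:M.

Definition Um (A : comNzRingType) (n : nat) : Type :=
  {v : 'rV[A]_n | unimodular v}.

(* The subgroup of GL_n(A) generated by the elementary matrices. *)
Inductive elementary_group (A : comNzRingType) (n : nat) : 'M[A]_n -> Prop :=
| elementary_gen (i j : 'I_n) (a : A) :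
    i != j -> elementary_group (1%:M + a *: delta_mx i j)
| elementary_one : elementary_group 1%:M
| elementary_mul (M N : 'M[A]_n) :
    elementary_group M -> elementary_group N -> elementary_group (M *m N)
| elementary_inv (M N : 'M[A]_n) :
    elementary_group M -> M *m N = 1%:M -> elementary_group N.

Definition row_cons (A : comNzRingType) (n : nat) (a : A) (r : 'rV[A]_n) :
  'rV[A]_n.+1 := row_mx (a%:M : 'M[A]_1) r.

Definition weak_mennicke_symbol (A : comNzRingType) (n : nat) (G : groupType)
    (phi : Um A n.+1 -> G) : Prop :=
  [/\ forall h : unimodular (row_cons 1 (0 : 'rV[A]_n)),
        phi (exist _ _ h) = 1%g,
      forall (v : 'rV[A]_n.+1) (e : 'M[A]_n.+1)
             (h : unimodular v) (he : unimodular (v *m e)),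
        elementary_group e -> phi (exist _ _ h) = phi (exist _ _ he)
    & forall (a : A) (r : 'rV[A]_n)
             (h1 : unimodular (row_cons a r))
             (h2 : unimodular (row_cons (1 - a) r))
             (h3 : unimodular (row_cons (a * (1 - a)) r)),
        (phi (exist _ _ h1) * phi (exist _ _ h2))%g = phi (exist _ _ h3)].

(* [G] is WMS_{n+1}(A), with its canonical symbol [phi]. *)
Definition universal_weak_mennicke_symbol (A : comNzRingType) (n : nat)
    (G : groupType) (phi : Um A n.+1 -> G) : Prop :=
  weak_mennicke_symbol phi /\
  forall (H : groupType) (psi : Um A n.+1 -> H),
    weak_mennicke_symbol psi ->
    exists2 f : {multiplicative G -> H},
      (forall u, f (phi u) = psi u) &
      forall g : {multiplicative G -> H},
        (forall u, g (phi u) = psi u) -> g =1 f.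

Definition divisible_group (G : groupType) : Prop :=
  forall (k : nat) (x : G), (0 < k)%N -> exists y : G, (y ^+ k)%g = x.

(* Main.v *)
Require Import Defs.
From HB Require Import structures.
From mathcomp Require Import all_boot all_order all_algebra.
From mathcomp Require Import all_classical all_reals ereal.
From mathcomp Require Import ring lra complex.
Set Implicit Arguments.
Unset Strict Implicit.
Unset Printing Implicit Defensive.
Import Order.TTheory GRing.Theory Num.Theory.
Local Open Scope classical_set_scope.
Local Open Scope ring_scope.

(** Write [v] for the value of the symbol at a row v. The target of the
    universal symbol maps in only one way compatible with these values, so it is
    abelian once the values commute with each other, and divisible once each
    value has roots of all orders (universal_commutative, universal_divisible).

    Values commute because the relation [a, c][1 - a, c] = [a(1 - a), c] is
    symmetric in a and 1 - a, and because two rows (x, v) and (y, w) with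
    comaximal tails can be moved to the form (a, c), (1 - a, c): adjust x and y
    by their tails until they add up to 1, then glue the tails by the Chinese
    remainder theorem (map_commute).

    For roots, move a given row by elementary operations to (a, v), where v has
    d entries in general position. These d equations cut the spectrum, of
    dimension d, down to closed points, and they have no common zero on the real
    locus, whose dimension is less than d; so every residue field of R/(v) is
    the field of complex numbers (general_position_row, residue_power). The unit
    a is a k-th power in each residue field, hence in R/(v) by Newton's method
    and by gluing along idempotents (power_lift): a = b^k modulo v.

    It remains to see that x |-> [x, v] is multiplicative on the units of R/(v),
    for then [a, v] = [b, v]^k (map_mul, map_exp). The defining relation
    only speaks of x + y = 1. Moving two rows to a common tail on which the
    first entries do add up to 1, and evaluating the outcome, yields
       [x, b, v'] [y, b, v'] = [x y, (x + y) b, v']    for x in 1 + yR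
    (map_mul_comaximal). If x + y is a square modulo v, then x and y have
    representatives of this kind with x + y = t^2 and t a unit modulo x y, and
    such a factor t^2 can be dropped (square_equiv). Every unit of R/(v) is a
    square, so this settles the case where x + y is a unit; the general case
    follows on multiplying x by a generic real scalar, which does not change
    the symbol because the symbol of a scalar is trivial. *)

(** * Rows up to elementary transformations *)

Definition row_ideal (A : comNzRingType) (n : nat) (v : 'rV[A]_n) : set A :=
  [set x | exists w : 'cV[A]_n, x = (v *m w) 0 0].

Definition elementary_equiv (A : comNzRingType) (n : nat) (v w : 'rV[A]_n) :=
  exists2 e : 'M[A]_n, elementary_group e & w = v *m e.

Section ElementaryEquivalence.
Variable A : comNzRingType.

Lemma elementary_invertible n (e : 'M[A]_n) :
  elementary_group e -> exists2 f, elementary_group f & e *m f = 1%:M.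
Proof.
elim=> [i j a nij||M N _ [M' eM' MM'] _ [N' eN' NN']|M N eM _ MN].
- exists (1%:M + (- a) *: delta_mx i j); first exact: elementary_gen.
  rewrite mulmxDl mul1mx mulmxDr mulmx1 -scalemxAl -scalemxAr.
  rewrite mul_delta_mx_0 1?eq_sym // !scaler0 addr0 -addrA -scalerDl addNr.
  by rewrite scale0r addr0.
- by exists 1%:M; [exact: elementary_one | rewrite mulmx1].
- exists (N' *m M'); first exact: elementary_mul.
  by rewrite -mulmxA (mulmxA N) NN' mul1mx.
- by exists M => //; apply: mulmx1C.
Qed.

Lemma elementary_equiv_refl n (v : 'rV[A]_n) : elementary_equiv v v.
Proof. by exists 1%:M; [exact: elementary_one | rewrite mulmx1]. Qed.

Lemma elementary_equiv_trans n (u v w : 'rV[A]_n) :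
  elementary_equiv u v -> elementary_equiv v w -> elementary_equiv u w.
Proof.
move=> [e He ->] [f Hf ->]; exists (e *m f); first exact: elementary_mul.
by rewrite mulmxA.
Qed.

Lemma elementary_equiv_sym n (v w : 'rV[A]_n) :
  elementary_equiv v w -> elementary_equiv w v.
Proof.
move=> [e He ->]; have [f Hf ef] := elementary_invertible He.
by exists f => //; rewrite -mulmxA ef mulmx1.
Qed.

Lemma row_ideal_elementary n (v w : 'rV[A]_n) :
  elementary_equiv v w -> row_ideal w `<=` row_ideal v.
Proof. by move=> [e _ ->] x [u ->]; exists (e *m u); rewrite mulmxA. Qed.

Lemma unimodularE n (v : 'rV[A]_n) : unimodular v <-> row_ideal v 1.
Proof.
split=> [[w vw]|[w vw]]; exists w; first by rewrite vw mxE eqxx.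
by apply/matrixP=> i j; rewrite !ord1 -vw mxE eqxx.
Qed.

Lemma unimodular_elementary n (v w : 'rV[A]_n) :
  elementary_equiv v w -> unimodular v <-> unimodular w.
Proof.
move=> vw; rewrite !unimodularE; split; apply: row_ideal_elementary => //.
exact: elementary_equiv_sym.
Qed.

Lemma row_ideal0 n (v : 'rV[A]_n) : row_ideal v 0.
Proof. by exists 0; rewrite mulmx0 mxE. Qed.

Lemma row_idealD n (v : 'rV[A]_n) a x y :
  row_ideal v x -> row_ideal v y -> row_ideal v (a * x + y).
Proof.
move=> [w ->] [u ->]; exists (a *: w + u).
by rewrite mulmxDr -scalemxAr !mxE.
Qed.

Lemma row_idealMr n (v : 'rV[A]_n) x (a : A) : row_ideal v x -> row_ideal v (x * a).
Proof.
by move=> vx; rewrite mulrC -[a * x]addr0; apply: row_idealD (row_ideal0 v).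
Qed.

Lemma row_idealN n (v : 'rV[A]_n) x : row_ideal v x -> row_ideal v (- x).
Proof. by rewrite -mulrN1; apply: row_idealMr. Qed.

Lemma row_ideal_add n (v : 'rV[A]_n) x y :
  row_ideal v x -> row_ideal v y -> row_ideal v (x + y).
Proof. by move=> vx; rewrite -[x]mul1r; apply: row_idealD. Qed.

Lemma row_ideal_entry n (v : 'rV[A]_n) i : row_ideal v (v 0 i).
Proof.
by exists (delta_mx i 0); rewrite -colE mxE.
Qed.

Lemma row_cons_l n a (v : 'rV[A]_n) : row_cons a v 0 (lshift n (0 : 'I_1)) = a.
Proof. by rewrite (row_mxEl (a%:M : 'M_1) v) mxE eqxx mulr1n. Qed.

Lemma row_cons_r n a (v : 'rV[A]_n) i : row_cons a v 0 (rshift 1 i) = v 0 i.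
Proof. exact: (row_mxEr (a%:M : 'M_1) v). Qed.

Lemma row_consP n (v : 'rV[A]_n.+1) a (w : 'rV[A]_n) :
  v 0 (lshift n (0 : 'I_1)) = a -> (forall i, v 0 (rshift 1 i) = w 0 i) ->
  v = row_cons a w.
Proof.
move=> va vw; apply/matrixP=> i j; rewrite ord1.
have [k jk|k jk] := splitP (j : 'I_(1 + n)).
  have -> : j = lshift n (0 : 'I_1) by apply/val_inj; rewrite /= jk ord1.
  by rewrite row_cons_l.
have -> : j = rshift 1 k by exact/val_inj.
by rewrite row_cons_r.
Qed.

Lemma row_consD n a b (v w : 'rV[A]_n) :
  row_cons a v + row_cons b w = row_cons (a + b) (v + w).
Proof.
by apply: row_consP => [|i]; rewrite mxE ?row_cons_l ?row_cons_r // mxE.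
Qed.

Lemma row_consZ n a b (v : 'rV[A]_n) : b *: row_cons a v = row_cons (b * a) (b *: v).
Proof.
by apply: row_consP => [|i]; rewrite mxE ?row_cons_l ?row_cons_r // mxE.
Qed.

Lemma mul_row_cons n a (v : 'rV[A]_n) (w : 'cV[A]_n.+1) :
  (row_cons a v *m w) 0 0 = a * w 0 0 + (v *m (dsubmx (w : 'cV_(1 + n)))) 0 0.
Proof.
have := mul_row_col (a%:M : 'M_1) v (usubmx (w : 'cV_(1 + n)))
  (dsubmx (w : 'cV_(1 + n))).
rewrite vsubmxK => /matrixP/(_ 0 0); rewrite /row_cons => ->.
rewrite mxE; congr (_ + _); rewrite mul_scalar_mx !mxE; congr (a * w _ _).
by apply/val_inj.
Qed.

Lemma row_ideal_cons n a (v : 'rV[A]_n) x :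
  row_ideal (row_cons a v) x <-> exists b y, row_ideal v y /\ x = a * b + y.
Proof.
split=> [[w ->]|[b [_ [[w ->] ->]]]].
  rewrite mul_row_cons; eexists; eexists; split; last reflexivity.
  by eexists.
exists (col_mx (b%:M : 'M_1) w).
have /matrixP/(_ 0 0) := mul_row_col (a%:M : 'M_1) v (b%:M : 'M_1) w.
rewrite /row_cons => ->; rewrite [RHS]mxE; congr (_ + _).
by rewrite mul_scalar_mx !mxE eqxx mulr1n.
Qed.

Lemma row_cons_eta n (v : 'rV[A]_n.+1) : exists a w, v = row_cons a w.
Proof.
exists (v 0 (lshift n (0 : 'I_1))), (\row_i v 0 (rshift 1 i)).
by apply: row_consP => // i; rewrite mxE.
Qed.

Lemma elementary_equiv_cons n a (v w : 'rV[A]_n) :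
  elementary_equiv v w -> elementary_equiv (row_cons a v) (row_cons a w).
Proof.
move=> [e He ->]; exists (block_mx (1%:M : 'M_1) 0 0 e); last first.
  have := mul_row_block (a%:M : 'M_1) v (1%:M : 'M_1) 0 0 e.
  by rewrite /row_cons !mulmx0 !mulmx1 addr0 add0r => ->.
elim: He => [i j b nij||M N _ eM _ eN|M N _ eM MN].
- have -> : block_mx 1%:M 0 0 (1%:M + b *: delta_mx i j) =
     1%:M + b *: delta_mx (rshift 1 i) (rshift 1 j) :> 'M[A]_(1 + n).
    rewrite scalar_mx_block.
    have -> : delta_mx (rshift 1 i) (rshift 1 j) =
       block_mx 0 0 0 (delta_mx i j) :> 'M[A]_(1 + n).
      apply/matrixP=> k l; rewrite !mxE.
      case: (splitP k) => k' Hk; rewrite !mxE; case: (splitP l) => l' Hl;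
        rewrite !mxE !eqE /= Hk ?Hl ?ord1 //= ?eqn_add2l ?andbF //.
    by rewrite scale_block_mx add_block_mx !scaler0 !addr0.
  by apply: elementary_gen; rewrite eqE /= eqn_add2l.
- by rewrite -scalar_mx_block; exact: elementary_one.
- have -> : block_mx 1%:M 0 0 (M *m N) =
     block_mx 1%:M 0 0 M *m block_mx 1%:M 0 0 N :> 'M[A]_(1 + n).
    by rewrite mulmx_block !mulmx0 !mul0mx !mulmx1 !addr0 add0r.
  exact: elementary_mul.
- apply: (elementary_inv eM).
  have := mulmx_block (1%:M : 'M_1) 0 0 M (1%:M : 'M_1) 0 0 N.
  rewrite !mulmx0 !mul0mx !mulmx1 !addr0 add0r MN => ->.
  by rewrite -scalar_mx_block.
Qed.

(** Elementary matrices act on rows by adding a multiple of one entry to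
    another; the two block versions below are what the later moves use. *)
Lemma elementary_equiv_add n (v : 'rV[A]_n) i j a : i != j ->
  elementary_equiv v (v + (v 0 i * a) *: delta_mx 0 j).
Proof.
move=> nij; exists (1%:M + a *: delta_mx i j); first exact: elementary_gen.
rewrite mulmxDr mulmx1 -scalemxAr; congr (_ + _).
apply/matrixP => p q; rewrite !ord1 !mxE (bigD1 i) //= big1 => [|k nk].
  by rewrite addr0 !mxE !eqxx /=; case: eqP => _; rewrite ?mulr1 ?mulr0 // mulrC.
by rewrite !mxE (negbTE nk) mulr0.
Qed.

Lemma row_ideal_ind n (v : 'rV[A]_n) (P : A -> Prop) :
  P 0 -> (forall x i a, P x -> P (x + v 0 i * a)) ->
  forall x, row_ideal v x -> P x.
Proof.
move=> P0 PD _ [w ->]; rewrite mxE; elim/big_rec: _ => // i x _ Px.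
by rewrite addrC; apply: PD.
Qed.

Lemma elementary_equiv_head n x y (v : 'rV[A]_n) :
  row_ideal v (y - x) -> elementary_equiv (row_cons x v) (row_cons y v).
Proof.
suff H z : row_ideal v z ->
    elementary_equiv (row_cons x v) (row_cons (x + z) v).
  by move/H; rewrite addrC subrK.
move: z; apply: row_ideal_ind.
  by rewrite addr0; apply: elementary_equiv_refl.
move=> z i a H; apply: elementary_equiv_trans H _.
have := @elementary_equiv_add n.+1 (row_cons (x + z) v) (rshift 1 i) (lshift n (0 : 'I_1)) a.
move=> /(_ _)/elementary_equiv_trans; apply; first by rewrite eq_sym.
rewrite row_cons_r.
have -> : delta_mx 0 (lshift n (0 : 'I_1)) = row_cons 1 0 :> 'rV[A]_n.+1.
  by apply: row_consP => [|k]; rewrite !mxE ?eqxx // !eqE.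
rewrite row_consZ row_consD mulr1 scaler0 addr0 addrA.
exact: elementary_equiv_refl.
Qed.

Lemma elementary_equiv_tail n x (v w : 'rV[A]_n) :
  elementary_equiv (row_cons x v) (row_cons x (v + x *: w)).
Proof.
have -> : w = \sum_(i < n) w 0 i *: delta_mx 0 i by exact: row_sum_delta.
rewrite scaler_sumr; elim/big_rec: _.
  by rewrite addr0; apply: elementary_equiv_refl.
move=> i u _ H; apply: elementary_equiv_trans H _.
have := @elementary_equiv_add n.+1 (row_cons x (v + u)) (lshift n (0 : 'I_1)) (rshift 1 i) (w 0 i).
move=> /(_ _)/elementary_equiv_trans; apply; first by [].
rewrite row_cons_l.
have -> : delta_mx 0 (rshift 1 i) = row_cons 0 (delta_mx 0 i) :> 'rV[A]_n.+1.
  by apply: row_consP => [|k]; rewrite !mxE // !eqE /= eqn_add2l.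
rewrite row_consZ row_consD mulr0 addr0 scalerA (addrC (_ *: delta_mx _ _) u) addrA.
exact: elementary_equiv_refl.
Qed.

End ElementaryEquivalence.

(** * Rows with three distinguished entries *)

(** The square and product lemmas only change three entries of a row. The other
    entries r enter through the ideal they generate, modulo which the three
    entries can be changed freely. *)
Definition row3 (A : comNzRingType) (m : nat) (r : 'rV[A]_m) (a b c : A) :
  'rV[A]_m.+3 := row_cons a (row_cons b (row_cons c r)).

Section Row3.
Variables (A : comNzRingType) (m : nat) (r : 'rV[A]_m).
Implicit Types a b c q s t : A.
Local Notation row3 := (row3 r).
Local Notation "v '~' w" := (elementary_equiv v w) (at level 70).
Local Notation trans := elementary_equiv_trans.

Lemma row_ideal3 a b c x : row_ideal (row3 a b c) x <->
  exists u v w n, row_ideal r n /\ x = a * u + b * v + c * w + n.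
Proof.
split.
  move=> /row_ideal_cons[u [_ [/row_ideal_cons[v [_ [/row_ideal_cons[w [n
    [rn ->]]] ->]]] ->]]].
  by exists u, v, w, n; rewrite !addrA.
move=> [u [v [w [n [rn ->]]]]]; rewrite -!addrA.
do 2!(apply/row_ideal_cons; eexists; eexists; split; last reflexivity).
by apply/row_ideal_cons; exists w, n.
Qed.

Lemma row_ideal2 b c x : row_ideal (row_cons b (row_cons c r)) x <->
  exists v w n, row_ideal r n /\ x = b * v + c * w + n.
Proof.
split.
  move=> /row_ideal_cons[v [_ [/row_ideal_cons[w [n [rn ->]]] ->]]].
  by exists v, w, n; rewrite !addrA.
move=> [v [w [n [rn ->]]]]; rewrite -!addrA.
apply/row_ideal_cons; eexists; eexists; split; last reflexivity.
by apply/row_ideal_cons; exists w, n.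
Qed.

Lemma move0 a b c a' u v n : row_ideal r n -> a' - a = b * u + c * v + n ->
  row3 a b c ~ row3 a' b c.
Proof.
by move=> rn E; apply: elementary_equiv_head; apply/row_ideal2; exists u, v, n.
Qed.

Lemma move1 a b c b' u v n : row_ideal r n -> b' - b = a * u + c * v + n ->
  row3 a b c ~ row3 a b' c.
Proof.
move=> rn E; apply: trans (elementary_equiv_tail a _ (row_cons u 0)) _.
rewrite row_consZ row_consD scaler0 addr0.
apply/elementary_equiv_cons/elementary_equiv_head/row_ideal_cons.
by exists v, n; split=> //; rewrite opprD addrA E; ring.
Qed.

Lemma move2 a b c c' u v n : row_ideal r n -> c' - c = a * u + b * v + n ->
  row3 a b c ~ row3 a b c'.
Proof.
move=> rn E.
apply: trans (elementary_equiv_tail a _ (row_cons 0 (row_cons u 0))) _.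
rewrite !row_consZ !row_consD mulr0 scaler0 !addr0.
apply/elementary_equiv_cons.
apply: trans (elementary_equiv_tail b _ (row_cons v 0)) _.
rewrite row_consZ row_consD scaler0 addr0.
apply/elementary_equiv_cons/elementary_equiv_head.
suff -> : c' - (c + a * u + b * v) = n by [].
by transitivity (c' - c - (a * u + b * v)); [ring | rewrite E; ring].
Qed.

Local Notation r0 := (row_ideal0 r).

Lemma swap01 a b c : row3 a b c ~ row3 (- b) a c.
Proof.
apply: trans (@move1 a b c (b + a) 1 0 0 r0 _) _; first by ring.
apply: trans (@move0 a _ c (- b) (- 1) 0 0 r0 _) _; first by ring.
by apply: (@move1 _ _ c a 1 0 0 r0); ring.
Qed.

(** Whitehead's factorization of diag(t, 1/t) into elementary matrices, carried
    out modulo q and the entries of r. *)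
Lemma diag_equiv q b c t s : row_ideal (row_cons q r) (t * s - 1) ->
  row3 q b c ~ row3 q (t * b) (s * c).
Proof.
move=> /row_ideal_cons[h [n [rn E]]].
have nE : n = t * s - 1 - q * h by rewrite E addrAC subrr add0r.
have rnM x : row_ideal r (n * x) by apply: row_idealMr.
apply: trans (@move2 q b c (c + t * b) 0 t 0 r0 _) _; first by ring.
apply: trans (@move1 q b _ (- (s * c)) (h * b) (- s) (n * b) (rnM b) _) _.
  by rewrite nE; ring.
apply: trans (@move2 q _ _ (t * b) (h * c) t (n * c) (rnM c) _) _.
  by rewrite nE; ring.
apply: trans (@move2 q _ _ (t * b + s * c) 0 (-1) 0 r0 _) _; first by ring.
apply: trans (@move1 q _ _ (t * b) 0 1 0 r0 _) _; first by ring.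
by apply: (@move2 q _ _ (s * c) 0 (-1) 0 r0); ring.
Qed.

(** The transvection by the column (u, v) and the row (u', v') is not
    elementary of size 2 in general. The third entry q makes it so: q is used
    to store the scalar b u + c v, and since the column and the row are
    orthogonal the store can be emptied again. *)
Lemma transvection_equiv q b c u v u' v' : u * u' + v * v' = 0 ->
  row3 q b c ~ row3 q (b + (b * u + c * v) * u') (c + (b * u + c * v) * v').
Proof.
move=> uv; set h := b * u + c * v.
apply: trans (@move0 q b c (q + h) u v 0 r0 _) _; first by rewrite /h; ring.
apply: trans (@move1 _ b c (b + (q + h) * u') u' 0 0 r0 _) _; first by ring.
apply: trans (@move2 _ _ c (c + (q + h) * v') v' 0 0 r0 _) _; first by ring.
apply: trans (@move0 _ _ _ q (- u) (- v) 0 r0 _) _.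
  transitivity (- h - (q + h) * (u * u' + v * v')); last by rewrite /h; ring.
  by rewrite uv; ring.
apply: trans (@move1 _ _ _ (b + h * u') (- u') 0 0 r0 _) _; first by ring.
by apply: (@move2 _ _ _ (c + h * v') (- v') 0 0 r0); ring.
Qed.

Lemma move12 q b c b' c' : row_ideal (row_cons q r) (b' - b) ->
  row_ideal (row_cons q r) (c' - c) -> row3 q b c ~ row3 q b' c'.
Proof.
move=> /row_ideal_cons[h [n [rn E]]] /row_ideal_cons[h' [n' [rn' E']]].
apply: trans (@move1 q b c b' h 0 n rn _) (@move2 q b' c c' h' 0 n' rn' _).
  by rewrite E; ring.
by rewrite E'; ring.
Qed.

(** Complete (b, c), which is unimodular modulo q and r, to a matrix N of
    determinant 1. Then t (b, c) is the image of (b, c) under the conjugate of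
    diag(t, 1/t) by N, and the conjugates by N of the elementary matrices of
    size 2 are transvections. *)
Lemma scalar_equiv q b c t s : unimodular (row3 q b c) ->
  row_ideal (row_cons q r) (t * s - 1) ->
  row3 q b c ~ row3 q (t * b) (t * c).
Proof.
move=> /unimodularE/row_ideal3[g [u [v [n [rn E]]]]] ts1.
pose h := b * u + c * v; pose Q := row_ideal (row_cons q r).
have QM x y : Q x -> Q (x * y) by apply: row_idealMr.
have Qh : Q (h - 1).
  apply/row_ideal_cons; exists (- g), (- n); split; first exact: row_idealN.
  by rewrite E /h; ring.
apply: trans (@transvection_equiv q b c u v (- v) u _) _; first by ring.
(* In terms of the rows (b, c) and (- v, u) of N, the coordinates of the pair
   go from (1, 0) to (1, 1), then (t, 1), then (t, 0). *)
rewrite -/h; apply: trans (@move12 q _ _ (b - v) (c + u) _ _) _.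
- have -> : b - v - (b + h * - v) = (h - 1) * v by ring.
  exact: QM.
- have -> : c + u - (c + h * u) = (h - 1) * - u by ring.
  exact: QM.
apply: trans (@transvection_equiv q _ _ (- c) b ((t - 1) * b) ((t - 1) * c) _) _.
  by ring.
have -> : (b - v) * - c + (c + u) * b = h by rewrite /h; ring.
apply: trans (@move12 q _ _ (t * b - v) (t * c + u) _ _) _.
- have -> : t * b - v - (b - v + h * ((t - 1) * b)) = (h - 1) * ((1 - t) * b) by ring.
  exact: QM.
- have -> : t * c + u - (c + u + h * ((t - 1) * c)) = (h - 1) * ((1 - t) * c) by ring.
  exact: QM.
apply: trans (@transvection_equiv q _ _ u v (s * v) (- s * u) _) _.
  by ring.
have -> : (t * b - v) * u + (t * c + u) * v = t * h by rewrite /h; ring.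
apply: move12.
- have -> : t * b - (t * b - v + t * h * (s * v)) =
    (t * s - 1) * (- (h * v)) + (h - 1) * - v by ring.
  by apply: row_ideal_add; apply: QM.
- have -> : t * c - (t * c + u + t * h * (- s * u)) =
    (t * s - 1) * (h * u) + (h - 1) * u by ring.
  by apply: row_ideal_add; apply: QM.
Qed.

(** The class of a unit t in the second entry is not killed in general, but
    that of t^2 is: diag(t^2, 1) is diag(t, t) times diag(t, 1/t). *)
Lemma square_equiv q b c t s : unimodular (row3 q b c) ->
  row_ideal (row_cons q r) (t * s - 1) ->
  row3 q b c ~ row3 q (t ^+ 2 * b) c.
Proof.
move=> Uqbc ts1; apply: trans (scalar_equiv Uqbc ts1) _.
apply: trans (diag_equiv _ _ ts1) _; rewrite mulrA -expr2.
apply: move12; first by rewrite subrr; apply: row_ideal0.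
have -> : c - s * (t * c) = (t * s - 1) * - c by ring.
exact: row_idealMr.
Qed.

Lemma square_head_equiv a q c t s : unimodular (row3 a q c) ->
  row_ideal (row_cons q r) (t * s - 1) ->
  row3 a q c ~ row3 (t ^+ 2 * a) q c.
Proof.
move=> Ua /row_ideal_cons[h [n [rn E]]].
have sw := swap01 a q c.
apply: (trans sw).
apply: trans (square_equiv (s := s) _ _) (elementary_equiv_sym (swap01 _ _ _)).
  exact: (unimodular_elementary sw).1.
by apply/row_ideal_cons; exists (- h), n; split => //; rewrite E; ring.
Qed.

End Row3.

(** * Weak Mennicke maps *)

(** Weak Mennicke symbols as functions on all rows, so that rewriting a row does
    not involve a proof that it is unimodular. The normalization at (1, 0) is a
    separate hypothesis where it is used. *)
Definition weak_mennicke_map (A : comNzRingType) (n : nat) (G : groupType)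
    (F : 'rV[A]_n.+1 -> G) : Prop :=
  (forall v w, elementary_equiv v w -> F v = F w) /\
  (forall a v, unimodular (row_cons a v) -> unimodular (row_cons (1 - a) v) ->
     (F (row_cons a v) * F (row_cons (1 - a) v))%g = F (row_cons (a * (1 - a)) v)).

Section WeakMennickeMap.
Variables (A : comNzRingType) (G : groupType).

Lemma unimodular_cons n (v : 'rV[A]_n) a b :
  row_ideal v (a * b - 1) -> unimodular (row_cons a v).
Proof.
move=> ab; apply/unimodularE/row_ideal_cons; exists b, (1 - a * b).
split; last by ring.
by rewrite -opprB; apply: row_idealN.
Qed.

(** As in the Mennicke-Newman lemma, both rows are moved to a common tail on
    which the first entries add up to 1; there the defining relation applies.
    The resulting product X (1 - X) over the tail C is compared with x y by
    means of k = x + y: modulo C one has k X = x and k (1 - X) = y, so that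
    multiplying by the square k^2 gives x y, and C itself is k b + x y. *)
Lemma map_mul_comaximal m (r : 'rV[A]_m) (F : 'rV[A]_m.+3 -> G) x y b c e :
  weak_mennicke_map F -> x = 1 - y * e ->
  unimodular (row3 r x b c) -> unimodular (row3 r y b c) ->
  (F (row3 r x b c) * F (row3 r y b c))%g = F (row3 r (x * y) ((x + y) * b) c).
Proof.
move=> [FE FR] xE Ux Uy; have r0 := row_ideal0 r.
pose mu := e - 1; pose X := x - mu * b; pose C := b + y * X; pose k := x + y.
have YE : 1 - X = y * e + mu * b by rewrite /X xE; ring.
have eqX : elementary_equiv (row3 r x b c) (row3 r X C c).
  apply: elementary_equiv_trans (@move0 _ _ r x b c X (- mu) 0 0 r0 _) _.
    by rewrite /X; ring.
  by apply: (@move1 _ _ r X b c C y 0 0 r0); rewrite /C; ring.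
have eqY : elementary_equiv (row3 r y b c) (row3 r (1 - X) C c).
  apply: elementary_equiv_trans (@move1 _ _ r y b c (b + y) 1 0 0 r0 _) _.
    by ring.
  apply: elementary_equiv_trans (@move0 _ _ r y _ c (1 - X) mu 0 0 r0 _) _.
    by rewrite YE /mu; ring.
  by apply: (@move1 _ _ r _ _ c C (- y) 0 0 r0); rewrite /C /X xE /mu; ring.
rewrite (FE _ _ eqX) (FE _ _ eqY).
have UX := (unimodular_elementary eqX).1 Ux.
have UY := (unimodular_elementary eqY).1 Uy.
have {}FR := FR _ _ UX UY; rewrite {}FR.
have UXY : unimodular (row3 r (X * (1 - X)) C c).
  move/unimodularE/row_ideal_cons: UX => [u [i [Ci Ei]]].
  move/unimodularE/row_ideal_cons: UY => [v [j [Cj Ej]]].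
  apply/unimodularE/row_ideal_cons; exists (u * v), (j + i * ((1 - X) * v)).
  split; first by apply: row_ideal_add => //; apply: row_idealMr.
  by rewrite {1}Ej -{1}[(1 - X) * v]mul1r {1}Ei; ring.
have kC : row_ideal (row_cons C r) (k * (x + b - 2%:R * e * b + e ^+ 2 * (y + b)) - 1).
  (* The inverse of k comes from 1 = (x + y e)^2 and x y = C - k b. *)
  apply/row_ideal_cons; exists (1 - 2%:R * e + e ^+ 2), 0; split=> //.
  by rewrite /C /k /X /mu xE; ring.
apply: FE; apply: elementary_equiv_trans (square_head_equiv UXY kC) _.
apply: elementary_equiv_trans (@move0 _ _ r _ C c (x * y)
    (mu * (y - x + mu * C)) 0 0 r0 _) _.
  by rewrite /C /k /X /mu xE; ring.
by apply: (@move1 _ _ r _ C c _ (- 1) 0 0 r0); rewrite /C /k /X /mu xE; ring.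
Qed.
End WeakMennickeMap.

Section SymbolProducts.
Variables (A : comNzRingType) (G : groupType).

Definition unit_mod (I : set A) (x : A) := exists y, I (x * y - 1).

(** Once the first entries are a and 1 - a over a common tail, the defining
    relation computes both products as the value at a (1 - a). *)
Lemma map_commute n (F : 'rV[A]_n.+1 -> G) x y (v w : 'rV[A]_n) p q :
  weak_mennicke_map F ->
  unimodular (row_cons x v) -> unimodular (row_cons y w) ->
  row_ideal v p -> row_ideal w q -> p + q = 1 ->
  (F (row_cons x v) * F (row_cons y w) = F (row_cons y w) * F (row_cons x v))%g.
Proof.
move=> [FE FR] Ux Uy vp wq pq.
pose a := x + p * (1 - x - y); pose c := v + a *: (w - v).
have eqx : elementary_equiv (row_cons x v) (row_cons a c).
  apply: elementary_equiv_trans (elementary_equiv_tail _ _ _).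
  apply: elementary_equiv_head.
  by rewrite /a addrAC subrr add0r; apply: row_idealMr.
have eqy : elementary_equiv (row_cons y w) (row_cons (1 - a) c).
  have -> : c = w + (1 - a) *: (v - w).
    by apply/matrixP=> i j; rewrite !mxE; ring.
  apply: elementary_equiv_trans (elementary_equiv_tail _ _ _).
  apply: elementary_equiv_head; rewrite /a.
  have -> : p = 1 - q by rewrite -pq addrK.
  have -> : 1 - (x + (1 - q) * (1 - x - y)) - y = q * (1 - x - y) by ring.
  exact: row_idealMr.
rewrite (FE _ _ eqx) (FE _ _ eqy).
have Ua := (unimodular_elementary eqx).1 Ux.
have Ub := (unimodular_elementary eqy).1 Uy.
rewrite FR //; have := FR (1 - a) c Ub; rewrite subKr => -> //.
by rewrite mulrC.
Qed.

Lemma map_unit n (F : 'rV[A]_n.+2 -> G) (v : 'rV[A]_n.+1) u u' :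
  weak_mennicke_map F -> F (row_cons 1 0) = 1%g -> u * u' = 1 ->
  F (row_cons u v) = 1%g.
Proof.
move=> [FE _] F1 uu'; rewrite -F1; apply: FE.
pose w : 'rV[A]_n.+1 := row_cons 1 0.
apply: elementary_equiv_trans (elementary_equiv_tail u v (u' *: (w - v))) _.
rewrite scalerA uu' scale1r addrC subrK.
apply: elementary_equiv_trans (elementary_equiv_head (y := 1) _) _.
  by apply/row_ideal_cons; exists (1 - u), 0; split; [exact: row_ideal0 | ring].
have := elementary_equiv_tail 1 w (- w); rewrite scale1r subrr; exact.
Qed.

(** It suffices to find representatives of x and y to which map_mul_comaximal
    applies and whose sum is the square of a unit modulo x y. For any
    representative y, change z to be t = 1 + y k; then t is prime to y, and
    x1 = t^2 - y is 1 modulo y. *)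
Lemma map_mul_square m (r : 'rV[A]_m) (F : 'rV[A]_m.+3 -> G) b c x y z :
  let v := row_cons b (row_cons c r) in let I := row_ideal v in
  weak_mennicke_map F -> unit_mod I x -> unit_mod I y ->
  I (z ^+ 2 - (x + y)) ->
  (F (row_cons x v) * F (row_cons y v))%g = F (row_cons (x * y) v).
Proof.
move=> v I FW [x' Ix] [y' Iy] Iz; have [FE _] := FW.
have IM u w : I u -> I (u * w) by apply: row_idealMr.
have ID u w : I u -> I w -> I (u + w) by apply: row_ideal_add.
pose k := (z - 1) * y'; pose t := 1 + y * k.
pose e := 1 - k * (2%:R + y * k); pose x1 := 1 - y * e.
have x1E : x1 = t ^+ 2 - y by rewrite /x1 /e /t; ring.
have Ix1 : I (x1 - x).
  have -> : x1 - x =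
      (z ^+ 2 - (x + y)) + (y * y' - 1) * ((z - 1) * (1 + y * k + z)).
    by rewrite x1E /t /k; ring.
  by apply: ID => //; apply: IM.
have eqx : elementary_equiv (row_cons x v) (row_cons x1 v).
  exact: elementary_equiv_head.
have Ux : unimodular (row_cons x1 v).
  apply/(unimodular_elementary eqx); exact: unimodular_cons Ix.
have Uy : unimodular (row_cons y v) by exact: unimodular_cons Iy.
rewrite (FE _ _ eqx) (map_mul_comaximal FW (erefl x1) Ux Uy).
have -> : x1 + y = t ^+ 2 by rewrite x1E subrK.
rewrite -(FE (row_cons (x1 * y) v)).
  apply: FE; apply: elementary_equiv_head.
  have -> : x * y - x1 * y = (x1 - x) * - y by ring.
  exact: IM.
apply: (@square_equiv _ _ _ _ _ _ _ (t * (y * k ^+ 2) - t + 2%:R)).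
  apply: (@unimodular_cons _ _ _ _ (x' * y')); rewrite -/v -/I.
  have -> : x1 * y * (x' * y') - 1 = (x1 - x) * (y * x' * y') +
     (x * x' - 1) * (y * y') + (y * y' - 1) by ring.
  by apply: (ID _ _ _ Iy); apply: ID; apply: IM.
apply/row_ideal_cons; exists (k ^+ 2), 0; split; first exact: row_ideal0.
by rewrite x1E /t; ring.
Qed.

(** The sum x + y need not be a square modulo the tail. Replacing x by x u for a
    unit u of A does not change its value, because the value at u is trivial, and
    u can be chosen so that x u + y is a unit, hence a square. *)
Lemma map_mul m (r : 'rV[A]_m) (F : 'rV[A]_m.+3 -> G) b c :
  let v := row_cons b (row_cons c r) in let I := row_ideal v in
  weak_mennicke_map F -> F (row_cons 1 0) = 1%g ->
  (forall x, unit_mod I x -> exists z, I (z ^+ 2 - x)) ->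
  (forall x y, unit_mod I x -> unit_mod I y -> exists u u', [/\ u * u' = 1,
     unit_mod I (x + u), unit_mod I (x * u + y) & unit_mod I (x * y + u)]) ->
  forall x y, unit_mod I x -> unit_mod I y ->
  (F (row_cons x v) * F (row_cons y v))%g = F (row_cons (x * y) v).
Proof.
move=> v I FW F1 Isqr Igen x y Ix Iy.
have [u [u' [uu' xu xuy xyu]]] := Igen x y Ix Iy.
have Iu : unit_mod I u by exists u'; rewrite uu' subrr; apply: row_ideal0.
have unitM a b' : unit_mod I a -> unit_mod I b' -> unit_mod I (a * b').
  move=> [a1 Ia] [b1 Ib]; exists (a1 * b1).
  have -> : a * b' * (a1 * b1) - 1 = (a * a1 - 1) * (b' * b1) + (b' * b1 - 1) by ring.
  by apply: row_ideal_add => //; apply: row_idealMr.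
have mulu a : unit_mod I a -> unit_mod I (a + u) ->
    F (row_cons (a * u) v) = F (row_cons a v).
  move=> Ia /Isqr[z Iz]; rewrite -(map_mul_square FW Ia Iu Iz).
  by rewrite (@map_unit _ F v u u') // mulg1.
have [z Iz] := Isqr _ xuy.
rewrite -mulu // (map_mul_square FW (unitM _ _ Ix Iu) Iy Iz).
by rewrite mulrAC mulu //; apply: unitM.
Qed.

Lemma map_exp m (r : 'rV[A]_m) (F : 'rV[A]_m.+3 -> G) b c :
  let v := row_cons b (row_cons c r) in let I := row_ideal v in
  weak_mennicke_map F -> F (row_cons 1 0) = 1%g ->
  (forall x, unit_mod I x -> exists z, I (z ^+ 2 - x)) ->
  (forall x y, unit_mod I x -> unit_mod I y -> exists u u', [/\ u * u' = 1,
     unit_mod I (x + u), unit_mod I (x * u + y) & unit_mod I (x * y + u)]) ->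
  forall x k, unit_mod I x -> F (row_cons (x ^+ k) v) = (F (row_cons x v) ^+ k)%g.
Proof.
move=> v I FW F1 Isqr Igen x k [x' Ix].
have unitX j : unit_mod I (x ^+ j).
  exists (x' ^+ j); rewrite -exprMn -[X in _ - X](expr1n _ j) subrXX.
  exact: row_idealMr.
elim: k => [|k IHk]; first by rewrite expr0 expg0 (@map_unit _ F v 1 1) ?mulr1.
rewrite exprS expgS -IHk; symmetry; apply: map_mul => //.
by exists x'.
Qed.

End SymbolProducts.

(** * The target of a universal symbol *)

Section UniversalSymbol.
Variables (A : comNzRingType) (n : nat) (G : groupType) (phi : Um A n.+1 -> G).

(** The value off the unimodular rows is arbitrary: elementary matrices
    preserve unimodularity, so any constant keeps the map invariant. *)
Definition total_symbol (v : 'rV[A]_n.+1) : G :=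
  if pselect (unimodular v) is left Uv then phi (exist _ v Uv) else 1%g.

Lemma total_symbolE u : total_symbol (sval u) = phi u.
Proof.
case: u => v Uv; rewrite /total_symbol /=; case: pselect => // Uv'.
by rewrite (Prop_irrelevance Uv Uv').
Qed.

Lemma total_symbol_map : weak_mennicke_symbol phi -> weak_mennicke_map total_symbol.
Proof.
move=> [_ phiE phiR]; split=> [v w vw|a v Ua Ub].
  have [Uv|nUv] := pselect (unimodular v); last first.
    rewrite /total_symbol; case: pselect => // _; case: pselect => // Uw.
    by case: nUv; apply/(unimodular_elementary vw).
  have Uw : unimodular w by apply/(unimodular_elementary vw).
  case: vw Uw => e He -> Uw.
  rewrite -[v in LHS]/(sval (exist _ v Uv)) -[v *m e]/(sval (exist _ _ Uw)).
  by rewrite !total_symbolE; apply: phiE.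
have Uab : unimodular (row_cons (a * (1 - a)) v).
  move/unimodularE/row_ideal_cons: Ua => [x [i [vi Ei]]].
  move/unimodularE/row_ideal_cons: Ub => [y [j [vj Ej]]].
  apply/unimodularE/row_ideal_cons; exists (x * y), (j + i * ((1 - a) * y)).
  split; first by apply: row_ideal_add => //; apply: row_idealMr.
  by rewrite {1}Ej -{1}[(1 - a) * y]mul1r {1}Ei; ring.
have := phiR a v Ua Ub Uab; rewrite -!total_symbolE /=; exact.
Qed.

Lemma total_symbol1 : weak_mennicke_symbol phi -> total_symbol (row_cons 1 0) = 1%g.
Proof.
move=> [phi1 _ _]; have U1 : unimodular (row_cons 1 (0 : 'rV[A]_n)).
  by apply: (@unimodular_cons _ _ _ _ 1); rewrite mulr1 subrr; apply: row_ideal0.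
by have := phi1 U1; rewrite -total_symbolE.
Qed.

End UniversalSymbol.

Section KthPowers.
Variables (G : groupType) (k : nat).

Definition kth_power (x : G) : bool := `[< exists y : G, (y ^+ k)%g = x >].

Hypothesis mulC : forall x y : G, (x * y = y * x)%g.

Lemma kth_power_closed : group_closed kth_power.
Proof.
split; first by apply/asboolP; exists 1%g; rewrite expg1n.
move=> x y /asboolP[a <-] /asboolP[b <-]; apply/asboolP; exists (a / b)%g.
by rewrite expgMn ?expVgn //; apply: mulC.
Qed.

(** The argument records commutativity, on which the group structure of this
    type depends. *)
Definition kth_powers of (forall x y : G, (x * y = y * x)%g) :=
  {x : G | kth_power x}.
HB.instance Definition _ := SubChoice.on (kth_powers mulC).
HB.instance Definition _ :=
  SubChoice_isSubGroup.Build G kth_power (kth_powers mulC) kth_power_closed.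
End KthPowers.

Section UniversalTarget.
Variables (A : comNzRingType) (n : nat) (G : groupType) (phi : Um A n.+1 -> G).
Hypothesis phiU : universal_weak_mennicke_symbol phi.

Lemma universal_ext (H : groupType) (f g : {multiplicative G -> H}) :
  (forall u, f (phi u) = g (phi u)) -> f =1 g.
Proof.
move=> fg x; have [phiW phiH] := phiU.
have psiW : weak_mennicke_symbol (f \o phi).
  have [p1 pE pR] := phiW; split=> [h|v e h he He|a r h1 h2 h3] /=.
  - by rewrite p1; apply: (@mulgI _ (f 1%g)); rewrite -gmulfM !mulg1.
  - by congr (f _); apply: pE.
  - by rewrite -gmulfM (pR _ _ _ _ h3).
have [k _ kU] := phiH H (f \o phi) psiW.
by rewrite (kU f) // (kU g) // => u; rewrite /= fg.
Qed.

Lemma conj_multiplicative (y : G) : {morph (fun x => x ^ y)%g : a b / (a * b)%g}.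
Proof. by move=> a b; rewrite conjMg. Qed.

(** If y commutes with all values, then conjugation by y and the identity are
    morphisms with the same values, hence equal, and y is central. Applied to the
    values themselves this makes them central, and then to an arbitrary y. *)
Lemma universal_commutative :
  (forall u w, (phi u * phi w = phi w * phi u)%g) ->
  forall x y : G, (x * y = y * x)%g.
Proof.
move=> phiC.
pose conj y : {multiplicative G -> G} := HB.pack (fun x : G => (x ^ y)%g)
  (isMultiplicative.Build G G _ (conj_multiplicative y)).
have fixed (y : G) : (forall u, (phi u * y = y * phi u)%g) -> forall x, (x * y = y * x)%g.
  move=> yC x; suff E : (x ^ y)%g = x by rewrite -{2}E conjgE mulVKg.
  apply: (@universal_ext G (conj y) idfun) => u.
  by rewrite /= conjgE yC mulKg.
by move=> x y; apply/fixed => u; apply/esym/fixed => w.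
Qed.

(** The symbol takes its values in the subgroup of k-th powers, so it factors
    through a morphism from G to this subgroup. Followed by the inclusion, that
    morphism fixes the values, hence is the identity of G. *)
Lemma universal_divisible :
  (forall x y : G, (x * y = y * x)%g) ->
  (forall k u, (0 < k)%N -> exists y : G, (y ^+ k)%g = phi u) ->
  divisible_group G.
Proof.
move=> phiC phiD k x k0; have [[p1 pE pR] phiH] := phiU.
have phiP u : kth_power k (phi u) by apply/asboolP; apply: phiD.
pose H : groupType := kth_powers k phiC.
pose psi u : H := exist _ (phi u) (phiP u).
have psiW : weak_mennicke_symbol psi.
  split=> [h|v e h he He|a r h1 h2 h3]; apply/val_inj => /=.
  - by rewrite p1.
  - exact: pE.
  - exact: pR.
have [f fpsi _] := phiH H psi psiW.
have valfM : {morph (fun a => sval (f a)) : a b / (a * b)%g}.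
  by move=> a b; rewrite gmulfM.
pose g : {multiplicative G -> G} := HB.pack (fun a => sval (f a))
  (isMultiplicative.Build G G _ valfM).
suff <- : sval (f x) = x by have /asboolP := svalP (f x).
by apply: (@universal_ext G g idfun) => u; rewrite /= fpsi.
Qed.
End UniversalTarget.

(** * Ideals and primes of noetherian rings *)

Section Ideals.
Variable A : comNzRingType.
Implicit Types (I J P S : set A) (x y a b : A) (c : nat -> set A).

Definition ideal_set I := I 0 /\ forall a x y, I x -> I y -> I (a * x + y).

Definition ideal_generated S : set A :=
  [set x | forall I, ideal_set I -> S `<=` I -> I x].

Definition ideal_adjoin I x : set A := [set z | exists y a, I y /\ z = y + a * x].

Lemma ideal_setM I a x : ideal_set I -> I x -> I (a * x).
Proof. by move=> [I0 ID] Ix; rewrite -[_ * _]addr0; apply: ID. Qed.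

Lemma ideal_setD I x y : ideal_set I -> I x -> I y -> I (x + y).
Proof. by move=> [_ ID] Ix Iy; rewrite -[x]mul1r; apply: ID. Qed.

Lemma ideal_setN I x : ideal_set I -> I x -> I (- x).
Proof. by rewrite -mulN1r; apply: ideal_setM. Qed.

Lemma ideal_setB I x y : ideal_set I -> I x -> I y -> I (x - y).
Proof. by move=> II Ix Iy; apply: ideal_setD => //; apply: ideal_setN. Qed.

Lemma ideal_generated_ideal S : ideal_set (ideal_generated S).
Proof.
split=> [I [I0 _] _ //|a x y Sx Sy I II SI].
by apply: (II.2); [apply: Sx | apply: Sy].
Qed.

Lemma sub_ideal_generated S : S `<=` ideal_generated S.
Proof. by move=> x Sx I _; apply. Qed.

Lemma ideal_adjoin_ideal I x : ideal_set I -> ideal_set (ideal_adjoin I x).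
Proof.
move=> II; split=> [|a _ _ [y [b [Iy ->]]] [z [c [Iz ->]]]].
  by exists 0, 0; rewrite mul0r addr0; split=> //; case: II.
by exists (a * y + z), (a * b + c); split; [apply: (II.2) | ring].
Qed.

Lemma sub_ideal_adjoin I x : I `<=` ideal_adjoin I x.
Proof. by move=> y Iy; exists y, 0; rewrite mul0r addr0. Qed.

Lemma ideal_adjoin_mem I x : ideal_set I -> ideal_adjoin I x x.
Proof. by move=> [I0 _]; exists 0, 1; rewrite mul1r add0r. Qed.

Lemma ideal_adjoin_sub I J x : ideal_set J -> I `<=` J -> J x ->
  ideal_adjoin I x `<=` J.
Proof.
move=> IJ sIJ Jx _ [y [a [Iy ->]]]; apply: ideal_setD => //; first exact: sIJ.
exact: ideal_setM.
Qed.

Lemma proper_ideal_setP I : proper_ideal_set I <-> ideal_set I /\ ~ I 1.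
Proof.
split=> [[I0 I1 ID]|[[I0 ID] I1]].
  split; last by move=> /mem_set; rewrite (negbTE I1).
  split; first exact: set_mem.
  by move=> a x y /mem_set Ix /mem_set Iy; apply: set_mem; apply: ID.
split; first exact: mem_set.
  by apply/negP => /set_mem.
by move=> a x y /set_mem Ix /set_mem Iy; apply: mem_set; apply: ID.
Qed.

Lemma prime_idealP P : prime_ideal P <->
  [/\ ideal_set P, ~ P 1 & forall x y, P (x * y) -> P x \/ P y].
Proof.
split=> [[/proper_ideal_setP[IP P1] PM]|[IP P1 PM]].
  split=> // x y /mem_set /PM /orP[] /set_mem; [by left | by right].
split; first exact/proper_ideal_setP.
by move=> x y /set_mem /PM[] /mem_set Pxy; apply/orP; [left | right].
Qed.

Lemma prime_ideal_ideal P : prime_ideal P -> ideal_set P.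
Proof. by move=> /prime_idealP[]. Qed.

Lemma prime_ideal1 P : prime_ideal P -> ~ P 1.
Proof. by move=> /prime_idealP[]. Qed.

Lemma prime_idealX P x n : prime_ideal P -> P (x ^+ n) -> P x.
Proof.
move=> /prime_idealP[_ P1 PM]; elim: n => [|n IHn]; first by rewrite expr0.
by rewrite exprS => /PM[].
Qed.

Definition noetherian :=
  forall I, ideal_set I -> exists s : seq A, I = ideal_generated [set` s].

Hypothesis noethA : noetherian.

(** Otherwise dependent choice gives a strictly increasing sequence in F, whose
    union could not be finitely generated. *)
Lemma noetherian_maximal (F : set (set A)) :
  F `<=` ideal_set -> F !=set0 ->
  exists2 M, F M & forall I, F I -> M `<=` I -> I = M.
Proof.
move=> Fid [I0 FI0]; apply: contrapT => nomax.
have step (X : {I | F I}) : {Y : {J | F J} | sval X `<` sval Y}.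
  apply: cid; case: X => I FI /=; apply: contrapT => H; apply: nomax.
  exists I => // J FJ IJ; apply: contrapT => neq; apply: H.
  exists (exist _ J FJ) => /=; split=> // JI; apply: neq.
  by apply/seteqP.
pose c n := iter n (fun X => sval (step X)) (exist _ I0 FI0).
pose U : set A := [set x | exists n, sval (c n) x].
have cS n : sval (c n) `<` sval (c n.+1) := svalP (step (c n)).
have cle n m : (n <= m)%N -> sval (c n) `<=` sval (c m).
  elim: m => [|m IHm]; first by rewrite leqn0 => /eqP->.
  rewrite leq_eqVlt => /orP[/eqP-> //|]; rewrite ltnS => /IHm H.
  exact: subset_trans H (properW (cS m)).
have cid n : ideal_set (sval (c n)) by apply: Fid; apply: svalP.
have Uid : ideal_set U.
  split=> [|a x y [n nx] [m my]]; first by exists 0; case: (cid 0).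
  exists (maxn n m); apply: (cid _).2.
    by apply: cle nx; rewrite leq_maxl.
  by apply: cle my; rewrite leq_maxr.
have [s Us] := noethA Uid.
have [n cn] : exists n, [set` s] `<=` sval (c n).
  have : [set` s] `<=` U by rewrite Us; apply: sub_ideal_generated.
  elim: {Us} s => [|x s IHs] sU; first by exists 0 => x.
  have [n sn] : exists n, [set` s] `<=` sval (c n).
    by apply: IHs => y ys; apply: sU; rewrite /= inE ys orbT.
  have [m xm] : U x by apply: sU; rewrite /= inE eqxx.
  exists (maxn n m) => y /=; rewrite inE => /orP[/eqP->|ys].
    by apply: cle xm; rewrite leq_maxr.
  by apply: cle (sn _ ys); rewrite leq_maxl.
have [_] := cS n; apply => x xn.
have : U x by exists n.+1.
by rewrite Us; apply.
Qed.

(** An ideal maximal among those that contain I and avoid the multiplicative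
    set S is prime. *)
Lemma prime_avoiding I S : ideal_set I -> S 1 ->
  (forall x y, S x -> S y -> S (x * y)) -> (forall x, S x -> ~ I x) ->
  exists P, [/\ prime_ideal P, I `<=` P & forall x, S x -> ~ P x].
Proof.
move=> II S1 SM SI.
pose F : set (set A) := [set J | [/\ ideal_set J, I `<=` J & forall x, S x -> ~ J x]].
have [||P [IP sIP SP] Pmax] := @noetherian_maximal F.
- by move=> J [].
- by exists I; split.
exists P; split=> //; apply/prime_idealP; split=> //; first exact: SP.
move=> x y Pxy; apply: contrapT => /not_orP[nPx nPy].
have meets z : ~ P z -> exists u a, S u /\ P (u - a * z).
  move=> nPz; apply: contrapT => H; have : F (ideal_adjoin P z).
    split; first exact: ideal_adjoin_ideal.
      exact: subset_trans sIP (@sub_ideal_adjoin _ _).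
    move=> u Su [p [a [Pp E]]]; apply: H; exists u, a; split=> //.
    by rewrite E addrK.
  move=> /Pmax /(_ (@sub_ideal_adjoin _ _)) E; apply: nPz; rewrite -E.
  exact: ideal_adjoin_mem.
have [u [a [Su Pu]]] := meets x nPx; have [w [b [Sw Pw]]] := meets y nPy.
apply: (SP (u * w)); first exact: SM.
have -> : u * w = w * (u - a * x) + ((a * x) * (w - b * y) + a * b * (x * y)) by ring.
by do 2?[apply: ideal_setD => //]; apply: ideal_setM.
Qed.

Lemma prime_ideal_above I : ideal_set I -> ~ I 1 -> exists2 P, prime_ideal P & I `<=` P.
Proof.
move=> II I1; have [||x ->//|P [pP IP _]] := @prime_avoiding I [set 1] II.
- by [].
- by move=> x y -> ->; rewrite /= mulr1.
by exists P.
Qed.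

Lemma no_prime_ideal_above I : ideal_set I ->
  (forall P, prime_ideal P -> ~ I `<=` P) -> I 1.
Proof.
by move=> II H; apply: contrapT => /(prime_ideal_above II)[P pP]; apply: H.
Qed.

(** A list of primes over I that contains all the minimal ones. *)
Definition dominating_primes I (ps : seq (set A)) :=
  (forall p, p \in ps -> prime_ideal p /\ I `<=` p) /\
  forall P, prime_ideal P -> I `<=` P -> exists2 p, p \in ps & p `<=` P.

(** Noetherian induction: if M is maximal among the ideals without such a list,
    then M is proper and not prime: say x y lies in M but neither factor does. A prime over
    M contains x or y, so the lists for M + (x) and M + (y) together serve M. *)
Lemma finite_primes_above I : ideal_set I -> exists ps, dominating_primes I ps.
Proof.
move=> II; apply: contrapT => bad.
pose F : set (set A) := [set J | ideal_set J /\ ~ exists ps, dominating_primes J ps].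
have [||M [IM nM] Mmax] := @noetherian_maximal F.
- by move=> J [].
- by exists I.
have M1 : ~ M 1.
  move=> M1; apply: nM; exists [::]; split=> // P pP MP.
  by case: (prime_ideal1 pP); apply: MP.
have Mnp : ~ prime_ideal M.
  move=> pM; apply: nM; exists [:: M]; split=> [p|P _ MP].
    by rewrite inE => /eqP->; split.
  by exists M => //; rewrite inE.
have [x [y [Mxy nMx nMy]]] : exists x y, [/\ M (x * y), ~ M x & ~ M y].
  apply: contrapT => H; apply: Mnp; apply/prime_idealP; split=> // x y Mxy.
  by apply: contrapT => /not_orP[nMx nMy]; apply: H; exists x, y.
have good z : ~ M z -> exists ps, dominating_primes (ideal_adjoin M z) ps.
  move=> nMz; apply: contrapT => H.
  have : F (ideal_adjoin M z) by split=> //; apply: ideal_adjoin_ideal.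
  move=> /Mmax /(_ (@sub_ideal_adjoin _ _)) E; apply: nMz; rewrite -E.
  exact: ideal_adjoin_mem.
have [ps [psp psH]] := good x nMx; have [qs [qsp qsH]] := good y nMy.
apply: nM; exists (ps ++ qs); split=> [p|P pP MP].
  rewrite mem_cat => /orP[/psp|/qsp] [pp Mp]; split=> //;
  by apply: subset_trans Mp; apply: sub_ideal_adjoin.
have IP := prime_ideal_ideal pP; have /prime_idealP[_ _ PM] := pP.
have [Px|Py] := PM _ _ (MP _ Mxy).
  have [p pps pP'] := psH P pP (ideal_adjoin_sub IP MP Px).
  by exists p; rewrite ?mem_cat ?pps.
have [p pqs pP'] := qsH P pP (ideal_adjoin_sub IP MP Py).
by exists p; rewrite ?mem_cat ?pqs ?orbT.
Qed.

(** * General position *)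

(** The primes over S that miss a form chains of length less than n: the part
    of V(S) where a is invertible has dimension less than n. *)
Definition dim_lt a S n :=
  forall c : nat -> set A, prime_chain n c -> S `<=` c 0%N -> c n a.

Lemma prime_chain_sub n c i : prime_chain n c -> (i <= n)%N -> c i `<=` c n.
Proof.
move=> [_ cS]; elim: n cS => [|n IHn] cS; first by rewrite leqn0 => /eqP->.
rewrite leq_eqVlt => /orP[/eqP-> //|]; rewrite ltnS => lin.
apply: subset_trans (properW (cS n (ltnSn n))); apply: IHn => // j ljn.
by apply: cS; apply: ltnW.
Qed.

Lemma prime_chain_extend n c P : prime_chain n c -> prime_ideal P ->
  P `<` c 0%N -> prime_chain n.+1 (fun i => if i is j.+1 then c j else P).
Proof. by move=> [cp cS] pP Pc; split=> [[|i]|[|i]] //= lin; [exact: cp | exact: cS]. Qed.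

Lemma dim_lt_sub a S S' n : S `<=` S' -> dim_lt a S n -> dim_lt a S' n.
Proof. by move=> SS' H c cc S'c; apply: H => //; apply: subset_trans S'c. Qed.

Hypothesis natA_unit : forall n, exists u : A, n.+1%:R * u = 1.

(** Two values of n for the same p would put a multiple of a by a unit in p, so
    each p excludes at most one n. *)
Lemma avoid_primes a b (ps : seq (set A)) :
  (forall p, p \in ps -> prime_ideal p) ->
  exists N : nat, forall n p, (N <= n)%N -> p \in ps -> ~ p a -> ~ p (b + n%:R * a).
Proof.
elim: ps => [|p ps IHps] psp; first by exists 0%N.
have [N NH] : exists N : nat, forall n p, (N <= n)%N -> p \in ps -> ~ p a ->
    ~ p (b + n%:R * a).
  by apply: IHps => q qps; apply: psp; rewrite inE qps orbT.
have pp : prime_ideal p by apply: psp; rewrite inE eqxx.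
have [M MH] : exists M : nat, forall n, (M <= n)%N -> ~ p a -> ~ p (b + n%:R * a).
  have [[m [pa pm]]|H] := pselect (exists m : nat, ~ p a /\ p (b + m%:R * a)); last first.
    by exists 0%N => n _ pa pn; apply: H; exists n.
  exists m.+1 => n lmn _ pn; apply: pa; have [u uE] := natA_unit (n - m.+1).
  have Ip := prime_ideal_ideal pp.
  have -> : a = u * ((b + n%:R * a) - (b + m%:R * a)).
    rewrite subnSK // natrB 1?ltnW // in uE.
    by transitivity ((n%:R - m%:R) * u * a); [rewrite uE mul1r | ring].
  by apply: ideal_setM => //; apply: ideal_setB.
exists (maxn N M) => n q; rewrite geq_max => /andP[lN lM].
by rewrite inE => /orP[/eqP->|]; [exact: MH | exact: NH].
Qed.

(** No minimal prime of S that misses a contains b, so a chain of primes over S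
    and b that misses a extends downwards by one of them. *)
Lemma dim_lt_adjoin a b S ps n : dominating_primes (ideal_generated S) ps ->
  (forall p, p \in ps -> ~ p a -> ~ p b) ->
  dim_lt a S n.+1 -> dim_lt a (S `|` [set b]) n.
Proof.
move=> [psp psS] psb dS c cc Sbc; apply: contrapT => ca.
have pc0 : prime_ideal (c 0%N) by apply: cc.1.
have [p pps pc] : exists2 p, p \in ps & p `<=` c 0%N.
  apply: psS => // x; apply; first exact: prime_ideal_ideal.
  by move=> y Sy; apply: Sbc; left.
have pa : ~ p a by move=> /pc /(prime_chain_sub cc (leq0n n)).
have pb := psb p pps pa; have [pp Sp] := psp p pps.
apply: ca; apply: (dS _ (prime_chain_extend cc pp _)).
  by split=> // cp; apply: pb; apply: cp; apply: Sbc; right.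
exact: subset_trans (@sub_ideal_generated S) Sp.
Qed.

(** Each b i is changed by a multiple of a so as to lower the dimension of two
    closed sets by one at once. Multiples of a are the changes that elementary
    moves allow when a is the remaining entry of the row. *)
Lemma general_position a (b : nat -> A) S T p q n :
  dim_lt a S (n + p) -> dim_lt a T (n + q) ->
  exists c : nat -> A, [/\ forall i, exists u, c i = b i + u * a,
    dim_lt a (S `|` [set c i | i in `I_n]) p &
    dim_lt a (T `|` [set c i | i in `I_n]) q].
Proof.
elim: n p q => [|n IHn] p q dS dT.
  exists b; split; first by move=> i; exists 0; rewrite mul0r addr0.
    by apply: dim_lt_sub dS => x; left.
  by apply: dim_lt_sub dT => x; left.
rewrite !addSnnS in dS dT; have [c [cb cS cT]] := IHn _ _ dS dT.
have [ps psH] := finite_primes_above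
  (ideal_generated_ideal (S `|` [set c i | i in `I_n])).
have [qs qsH] := finite_primes_above
  (ideal_generated_ideal (T `|` [set c i | i in `I_n])).
have [N NH] : exists N : nat, forall m p, (N <= m)%N -> p \in ps ++ qs ->
    ~ p a -> ~ p (b n + m%:R * a).
  apply: avoid_primes => P; rewrite mem_cat.
  by move=> /orP[/psH.1|/qsH.1] [].
pose bn := b n + N%:R * a.
pose c' i := if (i < n)%N then c i else b i + N%:R * a.
have sub (U : set A) : (U `|` [set c i | i in `I_n]) `|` [set bn] `<=`
    U `|` [set c' i | i in `I_n.+1].
  move=> x [[Ux|[i lin <-]]|->]; [by left | right | right].
    by exists i; [exact: ltnW | rewrite /c' lin].
  by exists n; [exact: ltnSn | rewrite /c' ltnn].
exists c'; split.
- move=> i; rewrite /c'; case: ifP => _; first exact: cb.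
  by exists N%:R.
- apply: dim_lt_sub (sub S) (dim_lt_adjoin psH _ cS) => P Pps.
  by apply: NH; rewrite ?mem_cat ?Pps.
- apply: dim_lt_sub (sub T) (dim_lt_adjoin qsH _ cT) => P Pqs.
  by apply: NH; rewrite ?mem_cat ?Pqs ?orbT.
Qed.
End Ideals.

(** * Finitely generated algebras are noetherian *)

Lemma noetherian_field (K : fieldType) : noetherian K.
Proof.
move=> I II; have [[x [Ix x0]]|nI] := pselect (exists x, I x /\ x != 0).
  exists [:: 1]; apply/seteqP; split=> y Hy.
    move=> J IJ sJ; rewrite -[y]mulr1; apply: ideal_setM => //.
    by apply: sJ; rewrite /= inE.
  have I1 : I 1 by rewrite -(mulVf x0); apply: ideal_setM.
  by rewrite -[y]mulr1; apply: ideal_setM.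
exists [::]; apply/seteqP; split=> y Hy.
  have -> : y = 0 by apply/eqP; apply: contrapT => /negP y0; apply: nI; exists y.
  exact: (ideal_generated_ideal _).1.
by apply: Hy => // x.
Qed.

Lemma noetherian_surj (A B : comNzRingType) (f : {rmorphism A -> B}) :
  (forall b, exists a, f a = b) -> noetherian A -> noetherian B.
Proof.
move=> fsurj noethA I II; pose J : set A := f @^-1` I.
have IJ : ideal_set J.
  split=> [|a x y Jx Jy]; first by rewrite /J /= rmorph0; case: II.
  by rewrite /J /= rmorphD rmorphM; apply: (II.2).
have [s Js] := noethA J IJ; exists (map f s); apply/seteqP; split=> y Hy.
  move=> L IL sL; have [x xy] := fsurj y; rewrite -xy.
  have : J x by rewrite /J /= xy.
  rewrite Js => /(_ (f @^-1` L)); apply; last first.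
    by move=> z zs; apply: sL; apply: map_f.
  split=> [|a u v Lu Lv]; first by rewrite /= rmorph0; case: IL.
  by rewrite /= rmorphD rmorphM; apply: (IL.2).
apply: Hy => // z /= /mapP[x xs ->]; suff: J x by [].
by rewrite Js; apply: sub_ideal_generated.
Qed.

(** If I is not finitely generated, keep choosing f n in I outside the ideal of
    the previous choices and of least possible size. The ideals generated by
    the first n leading coefficients become stationary; at that stage the
    leading term of f n can be cancelled by earlier choices, which gives a
    smaller element that was available. *)
Theorem hilbert_basis (R : comNzRingType) : noetherian R -> noetherian {poly R}.
Proof.
move=> noethR I II; apply: contrapT => nfg.
pose gen (s : seq {poly R}) := ideal_generated [set` s].
pose minimal s (f : {poly R}) := [/\ I f, ~ gen s f &
  forall g, I g -> ~ gen s g -> (size f <= size g)%N].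
have next s : [set` s] `<=` I -> exists f, minimal s f.
  move=> sI; have [f [If nf]] : exists f, I f /\ ~ gen s f.
    apply: contrapT => H; apply: nfg; exists s; apply/seteqP; split=> g Hg.
      by apply: contrapT => ng; apply: H; exists g.
    exact: Hg.
  have [n] := ubnP (size f); elim: n f If nf => // n IHn f If nf.
  have [[g [Ig ng gf]]|H _] := pselect (exists g,
    [/\ I g, ~ gen s g & (size g < size f)%N]).
    by move=> lt; apply: (IHn g Ig ng); apply: leq_trans gf lt.
  exists f; split=> // g Ig ng.
  by rewrite leqNgt; apply/negP => gf; apply: H; exists g.
pose inI (s : seq {poly R}) := [set` s] `<=` I.
have step (s : sig inI) : {f | minimal (sval s) f}.
  exact: cid (next _ (svalP s)).
have consI (s : sig inI) : inI (sval (step s) :: sval s).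
  move=> g /=; rewrite inE => /orP[/eqP->|gs]; last exact: (svalP s).
  by case: (svalP (step s)).
have nilI : inI [::] by move=> g.
pose c n := iter n (fun s => exist inI _ (consI s)) (exist inI _ nilI).
pose f n := sval (step (c n)).
have fP n : minimal (sval (c n)) (f n) := svalP (step (c n)).
have cle i n : (i <= n)%N -> {subset sval (c i) <= sval (c n)}.
  elim: n => [|n IHn]; first by rewrite leqn0 => /eqP->.
  rewrite leq_eqVlt => /orP[/eqP->//|]; rewrite ltnS => /IHn H g /H gc.
  by rewrite /= inE gc orbT.
have fc i n : (i < n)%N -> f i \in sval (c n).
  by move=> /cle; apply; rewrite /= inE eqxx.
have szf i n : (i < n)%N -> (size (f i) <= size (f n))%N.
  move=> lin; have [_ _ fmin] := fP i; have [If nf _] := fP n.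
  apply: fmin => // gi; apply: nf => J IJ sJ; apply: gi => // g /=.
  by move=> /(cle _ _ (ltnW lin)) /sJ.
pose L n : set R := ideal_generated [set lead_coef (f i) | i in `I_n].
have [||_ [n _ <-] Lmax] := noetherian_maximal noethR (F := range L).
- by move=> _ [n _ <-]; apply: ideal_generated_ideal.
- by exists (L 0%N), 0%N.
have Ln : L n (lead_coef (f n)).
  rewrite -[L n](Lmax (L n.+1)); first by apply: sub_ideal_generated; exists n => /=.
    by exists n.+1.
  move=> x Lx J IJ sJ; apply: Lx => // _ [i lin <-]; apply: sJ.
  by exists i => //=; apply: ltnW.
have [If nf fmin] := fP n.
have f0 : f n != 0.
  by apply/eqP => f0; apply: nf; rewrite f0; apply: (ideal_generated_ideal _).1.
pose W : set R := [set x | exists g, [/\ gen (sval (c n)) g,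
  (size g <= size (f n))%N & g`_(size (f n)).-1 = x]].
have [g [Gg szg gE]] : W (lead_coef (f n)).
  apply: Ln => [|_ [i lin <-]].
    split=> [|a _ _ [g [Gg szg <-]] [h [Gh szh <-]]].
      exists 0; rewrite coef0 size_poly0; split=> //.
      exact: (ideal_generated_ideal _).1.
    exists (a%:P * g + h); rewrite coefD coefCM; split=> //.
      exact: (ideal_generated_ideal _).2.
    apply: leq_trans (size_polyD _ _) _; rewrite geq_max szh andbT.
    by rewrite mul_polyC; apply: leq_trans (size_scale_leq _ _) szg.
  have szi := szf _ _ lin; exists ('X^(size (f n) - size (f i)) * f i).
  have fi0 : f i != 0.
    have [_ nfi _] := fP i.
    by apply/eqP => fi0; apply: nfi; rewrite fi0; apply: (ideal_generated_ideal _).1.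
  split.
  - apply: (ideal_setM _ (ideal_generated_ideal [set` sval (c n)])).
    by apply: sub_ideal_generated; apply: fc.
  - by rewrite mulrC size_mulXn // subnK.
  - have <- : lead_coef ('X^(size (f n) - size (f i)) * f i) = lead_coef (f i).
      by rewrite lead_coef_monicM // monicXn.
    by rewrite lead_coefE [in RHS]mulrC size_mulXn // subnK // mulrC.
have : (size (f n - g)%R < size (f n))%N.
  have fn_gt0 : (0 < size (f n))%N by rewrite size_poly_gt0.
  rewrite -(ltn_predK fn_gt0) ltnS; apply/leq_sizeP => j.
  rewrite leq_eqVlt coefB => /orP[/eqP <-|lj].
    by rewrite gE lead_coefE subrr.
  rewrite !nth_default ?subrr //; last by rewrite -(ltn_predK fn_gt0).
  by apply: leq_trans szg _; rewrite -(ltn_predK fn_gt0).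
rewrite ltnNge => /negP; apply; apply: fmin.
  apply: ideal_setB => //; apply: Gg => // h; exact: (svalP (c n)).
move=> Gfg; apply: nf; rewrite -[f n](subrK g).
exact: (ideal_setD (ideal_generated_ideal _) Gfg Gg).
Qed.

Definition subring_set (A : comNzRingType) (S : set A) :=
  [/\ S 1, forall x y, S x -> S y -> S (x - y)
    & forall x y, S x -> S y -> S (x * y)].

(** Adjoining the generators one at a time reduces to a polynomial ring over
    the previous base, hence the quantification over the base. *)
Lemma noetherian_generated (A : comNzRingType) (s : seq A)
    (R : comNzRingType) (f : {rmorphism R -> A}) :
  noetherian R ->
  (forall S : set A, subring_set S -> (forall r, S (f r)) ->
     (forall x, x \in s -> S x) -> forall a, S a) ->
  noetherian A.
Proof.
elim: s R f => [|t s IHs] R f noethR gen.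
  apply: (noetherian_surj (f := f) _ noethR) => a.
  apply: (gen [set b | exists r, f r = b]) => // [|r]; last by exists r.
  split; first by exists 1; rewrite rmorph1.
    by move=> _ _ [x <-] [y <-]; exists (x - y); rewrite rmorphB.
  by move=> _ _ [x <-] [y <-]; exists (x * y); rewrite rmorphM.
have cft : commr_rmorph f t by move=> x; apply: mulrC.
apply: (IHs _ (horner_morph cft)) => [|S subS Sf Ss a].
  exact: hilbert_basis.
apply: gen => // [r|x]; first by rewrite -(horner_morphC cft); apply: Sf.
rewrite inE => /orP[/eqP->|]; last exact: Ss.
by rewrite -(horner_morphX cft); apply: Sf.
Qed.

Lemma noetherian_finitely_generated (K : fieldType) (A : comAlgType K) :
  finitely_generated_algebra A -> noetherian A.
Proof.
move=> [s gen]; apply: (noetherian_generated (s := s) (f := in_alg A)).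
  exact: noetherian_field.
move=> S [S1 SB SM] Sf Ss a; apply/set_mem; apply: (gen (mem S)).
  have S0 : S 0 by rewrite -(subrr 1); apply: SB.
  split; [exact: mem_set | | ].
    move=> k x y /set_mem Sx /set_mem Sy; apply: mem_set.
    rewrite -mulr_algl -[y]opprK -[- y]add0r; apply: (SB); last exact: SB.
    by apply: SM => //; apply: Sf.
  by move=> x y /set_mem Sx /set_mem Sy; apply: mem_set; apply: SM.
by move=> x /Ss; apply: mem_set.
Qed.

(** * Residue fields *)

Lemma real_not_enumerable (K : realType) (f : nat -> K) : exists x, forall n, f n != x.
Proof.
(* Nested intervals: the n-th step leaves f n outside. *)
pose step (ab : K * K) c : K * K := let m := (ab.1 + ab.2) / 2%:R in
  if c < m then (m, ab.2) else (ab.1, (ab.1 + m) / 2%:R).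
pose I := fix I n := if n is n'.+1 then step (I n') (f n') else (0, 1) : K * K.
have Ilt n : (I n).1 < (I n).2.
  elim: n => [|n IHn] /=; first exact: ltr01.
  by rewrite /step; case: ifP => _ /=; lra.
have Ile n : (I n).1 <= (I n.+1).1 /\ (I n.+1).2 <= (I n).2.
  have := Ilt n; rewrite /= /step; case: ifP => _ /= H; split => //; lra.
have Imono n m : (n <= m)%N -> (I n).1 <= (I m).1 /\ (I m).2 <= (I n).2.
  elim: m => [|m IHm]; first by rewrite leqn0 => /eqP->.
  rewrite leq_eqVlt => /orP[/eqP->//|]; rewrite ltnS => /IHm[H1 H2].
  have [H3 H4] := Ile m.
  by split; [exact: le_trans H1 H3 | exact: le_trans H4 H2].
pose E : set K := [set (I n).1 | n in setT].
have Eub n : ubound E (I n).2.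
  move=> _ [m _ <-]; have [H1 _] := Imono m (maxn m n) (leq_maxl _ _).
  have [_ H2] := Imono n (maxn m n) (leq_maxr _ _).
  exact: le_trans H1 (le_trans (ltW (Ilt _)) H2).
have E0 : E !=set0 by exists (I 0%N).1, 0%N.
exists (sup E) => n; apply/eqP => fn.
have supl k : (I k).1 <= sup E.
  apply: sup_ubound; last by exists k.
  by exists (I 0%N).2; apply: Eub.
have supr k : sup E <= (I k).2 by apply: sup_le_ub.
have := supl n.+1; have := supr n.+1; have := Ilt n; rewrite /= /step fn.
by case: ifPn => /=; rewrite -?leNgt => H1 H2 H3 H4; lra.
Qed.

(** A map with finite fibers to a countable type would enumerate the reals. *)
Lemma real_infinite_fiber (K : realType) (T : countType) (g : K -> T) :
  exists t, forall n, exists s : seq K, [/\ size s = n, uniq s & all (fun x => g x == t) s].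
Proof.
apply: contrapT => H.
have fin t : {s : seq K | forall x, g x = t -> x \in s}.
  apply: cid; apply: contrapT => Ht; apply: H; exists t; elim=> [|n [s [sz us gs]]].
    by exists [::].
  have [x [gx xs]] : exists x, g x = t /\ x \notin s.
    apply: contrapT => Hx; apply: Ht; exists s => x gx; apply: contrapT => /negP xs.
    by apply: Hx; exists x.
  by exists (x :: s); rewrite /= sz us gs gx eqxx xs.
pose h n : K := if unpickle n is Some (t, i) then nth 0 (sval (fin t)) i else 0.
have [x xh] := real_not_enumerable h.
have := xh (pickle (g x, index x (sval (fin (g x))))).
by rewrite /h pickleK nth_index ?eqxx //; apply: (svalP (fin (g x))).
Qed.

Lemma maximal_inverse (A : comNzRingType) (m : set A) x :
  maximal_ideal m -> ~ m x -> exists y, m (x * y - 1).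
Proof.
move=> [/proper_ideal_setP[Im m1] mmax] nmx.
have [[y [a [my E]]]|H] := pselect (ideal_adjoin m x 1).
  exists a; have -> : x * a - 1 = - y by rewrite E; ring.
  exact: ideal_setN.
case: nmx; rewrite -(mmax (ideal_adjoin m x)).
- exact: ideal_adjoin_mem.
- by apply/proper_ideal_setP; split=> //; apply: ideal_adjoin_ideal.
- exact: sub_ideal_adjoin.
Qed.

Lemma maximal_prime (A : comNzRingType) (m : set A) : maximal_ideal m -> prime_ideal m.
Proof.
move=> mm; have [/proper_ideal_setP[Im m1] _] := mm.
apply/prime_idealP; split=> // x y mxy; apply: contrapT => /not_orP[nx ny].
have [z mz] := maximal_inverse mm nx; apply: ny.
have -> : y = z * (x * y) - y * (x * z - 1) by ring.
by apply: ideal_setB => //; apply: ideal_setM.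
Qed.

Section Zariski.
Variables (K : realType) (A : comAlgType K).
Hypothesis fgA : finitely_generated_algebra A.

(** The products of generators, indexed by words in the generators, span. *)
Lemma countably_spanned : exists mon : seq nat -> A, forall a,
  exists P : seq (K * seq nat), a = \sum_(p <- P) p.1 *: mon p.2.
Proof.
have [s gen] := fgA; pose mon (w : seq nat) := \prod_(i <- w) s`_i.
exists mon => a; pose S : set A := [set a | exists P : seq (K * seq nat),
  a = \sum_(p <- P) p.1 *: mon p.2].
suff: S a by [].
apply/set_mem; apply: (gen (mem S)); last first.
  move=> x xs; apply: mem_set; exists [:: (1, [:: index x s])].
  by rewrite big_seq1 scale1r /mon big_seq1 nth_index.
split.
- by apply: mem_set; exists [:: (1, [::])]; rewrite big_seq1 scale1r /mon big_nil.
- move=> k _ _ /set_mem[P ->] /set_mem[Q ->]; apply: mem_set.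
  exists ([seq (k * p.1, p.2) | p <- P] ++ Q).
  rewrite big_cat big_map /= scaler_sumr; congr (_ + _).
  by apply: eq_bigr => p _; rewrite scalerA.
- move=> _ _ /set_mem[P ->] /set_mem[Q ->]; apply: mem_set.
  exists [seq (p.1 * q.1, p.2 ++ q.2) | p <- P, q <- Q].
  rewrite big_allpairs_dep mulr_suml; apply: eq_bigr => p _.
  rewrite mulr_sumr; apply: eq_bigr => q _ /=.
  by rewrite -scalerAl -scalerAr scalerA /mon big_cat.
Qed.

(** Zariski's lemma, by uncountability of the base field. If w were
    transcendental, each w - x with x in K would have an inverse modulo m. These
    inverses lie in a space of countable dimension, so more than n of them lie in
    the span of some n monomials. A linear relation between them, multiplied by
    the product of the w - x, is a polynomial equation for w. *)
Lemma residue_algebraic (m : set A) (w : A) : maximal_ideal m ->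
  exists2 f : {poly K}, f != 0 & m (horner_alg w f).
Proof.
move=> mm; have [/proper_ideal_setP[Im m1] _] := mm.
have Pm := maximal_prime mm.
apply: contrapT => transc.
have [mon span] := countably_spanned.
have inv x : {g : A | m ((w - x%:A) * g - 1)}.
  apply: cid; apply: maximal_inverse => // mx; apply: transc.
  exists ('X - x%:P); first by rewrite polyXsubC_eq0.
  by rewrite rmorphB /= horner_algX horner_algC.
pose P x := sval (cid (span (sval (inv x)))).
have PE x : sval (inv x) = \sum_(p <- P x) p.1 *: mon p.2 by rewrite /P; case: cid.
have [L Linf] := real_infinite_fiber (fun x => [seq p.2 | p <- P x]).
pose n := size L; have [s [sz us sL]] := Linf n.+1.
pose x (j : 'I_n.+1) := s`_j.
have xL j : [seq p.2 | p <- P (x j)] = L.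
  by apply/eqP; apply: (allP sL); rewrite mem_nth ?sz.
have xinj : injective x.
  by move=> i j /eqP; rewrite /x nth_uniq ?sz // => /eqP/val_inj.
pose M := \matrix_(j < n.+1, i < n) (nth (0, [::]) (P (x j)) i).1.
have gE j : sval (inv (x j)) = \sum_(i < n) M j i *: mon (nth [::] L i).
  rewrite PE (big_nth (0, [::])) big_mkord.
  have -> : size (P (x j)) = n by rewrite /n -(xL j) size_map.
  apply: eq_bigr => i _; rewrite mxE -{1}(xL j) (nth_map (0, [::])) //.
  by rewrite -(size_map snd) (xL j).
have [u uM u0] : exists2 u : 'rV_n.+1, u *m M = 0 & u != 0.
  have : kermx M != 0.
    rewrite kermx_eq0 /row_free; apply/negP => /eqP rM.
    by have := rank_leq_col M; rewrite rM ltnn.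
  by move=> /rowV0Pn[u /sub_kermxP uM u0]; exists u.
pose q j := \prod_(l < n.+1 | l != j) ('X - (x l)%:P).
pose f := \sum_j u 0 j *: q j.
apply: transc; exists f.
  have /rV0Pn[j uj] := u0.
  have : f.[x j] = u 0 j * \prod_(l < n.+1 | l != j) (x j - x l).
    rewrite horner_sum (bigD1 j) //= big1 ?addr0 => [|i ij].
      rewrite hornerZ /q horner_prod; congr (_ * _).
      by apply: eq_bigr => l _; rewrite hornerXsubC.
    by rewrite hornerZ /q horner_prod (bigD1 j) 1?eq_sym //= hornerXsubC subrr mul0r mulr0.
  move=> fE; apply/eqP => f0; move/eqP: fE; rewrite f0 horner0 eq_sym mulf_eq0 (negbTE uj) /=.
  by move=> /prodf_eq0[l lj]; rewrite subr_eq0 => /eqP/xinj/esym/eqP; rewrite (negbTE lj).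
pose W := \prod_(l < n.+1) (w - (x l)%:A).
have mj j : m (horner_alg w (q j) - sval (inv (x j)) * W).
  pose Q := \prod_(l < n.+1 | l != j) (w - (x l)%:A).
  have -> : horner_alg w (q j) = Q.
    by rewrite rmorph_prod; apply: eq_bigr => l _; rewrite rmorphB /= horner_algX horner_algC.
  rewrite /W (bigD1 j) //= -/Q.
  have -> : Q - sval (inv (x j)) * ((w - (x j)%:A) * Q) =
     - Q * ((w - (x j)%:A) * sval (inv (x j)) - 1) by ring.
  by apply: ideal_setM => //; apply: (svalP (inv (x j))).
have ugen : \sum_j u 0 j *: sval (inv (x j)) = 0.
  under eq_bigr => j _ do rewrite gE scaler_sumr.
  rewrite exchange_big big1 //= => i _.
  under eq_bigr => j _ do rewrite scalerA.
  rewrite -scaler_suml; have /matrixP/(_ 0 i) := uM.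
  by rewrite !mxE => ->; rewrite scale0r.
have -> : horner_alg w f = \sum_j u 0 j *: (horner_alg w (q j) - sval (inv (x j)) * W).
  under [RHS]eq_bigr => j _ do rewrite scalerBr scalerAl.
  rewrite sumrB -mulr_suml ugen mul0r subr0 rmorph_sum.
  by apply: eq_bigr => j _; rewrite -mul_polyC rmorphM /= horner_algC mulr_algl.
elim/big_rec: _ => [|j y _ my]; first by case: Im.
by apply: ideal_setD => //; rewrite -mulr_algl; apply: ideal_setM.
Qed.
End Zariski.

Section RealResidueField.
Variables (K : realType) (A : comAlgType K) (m : set A).
Hypothesis mm : maximal_ideal m.

Definition set_pred : pred A := fun x => `[< m x >].

Lemma set_pred_idealr : idealr_closed set_pred.
Proof.
have [[m0 m1 mD] _] := mm; split.
- by apply/asboolP; apply: set_mem.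
- by apply: contra m1 => /asboolP; apply: mem_set.
- move=> a x y /asboolP mx /asboolP my; apply/asboolP; apply: set_mem.
  by apply: mD; apply: mem_set.
Qed.

(** The composite of the structure map of A with the quotient by m is then a
    bijective ring morphism from K, and its inverse is the isomorphism asked
    for. *)
Lemma real_maximal_residue : (forall w, exists x : K, m (w - x%:A)) ->
  real_maximal_ideal m.
Proof.
move=> resK; split=> //.
pose I : idealr A := HB.pack set_pred (isIdealr.Build A set_pred set_pred_idealr).
exists I; split.
  by apply/seteqP; split=> x; [move=> /asboolP | move=> mx; apply/asboolP].
pose p : {rmorphism A -> {ideal_quot I}} := \pi_({ideal_quot I})%qT.
pose g : {rmorphism K -> {ideal_quot I}} := p \o in_alg A.
have ginj : injective g by exact: fmorph_inj.
have gsurj q : {x | g x = q}.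
  apply: cid; have [x mx] := resK (repr q); exists x.
  rewrite -[q]reprK; apply/eqP; rewrite eq_sym -Quotient.idealrBE.
  exact/asboolP.
pose f q := sval (gsurj q).
have fK : cancel f g by move=> q; apply: (svalP (gsurj q)).
have gK : cancel g f by move=> x; apply: ginj; rewrite fK.
pose fm : {rmorphism {ideal_quot I} -> K} := HB.pack f
  (GRing.isZmodMorphism.Build _ _ f (can2_zmod_morphism gK fK))
  (GRing.isMonoidMorphism.Build _ _ f (can2_monoid_morphism gK fK)).
by exists fm, g.
Qed.
End RealResidueField.

Section ComplexResidueField.
Variables (K : realType) (A : comAlgType K).
Implicit Types (m : set A) (u w i : A) (x y : K) (z : K[i]).

(** A real polynomial is a product of factors that are linear or of the form
    (X - x)^2 + y^2, by its complex roots, and m contains one of their values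
    at u. A linear factor counts as the case y = 0. *)
Lemma conjugate_roots m u (f : {poly K}) : prime_ideal m -> f != 0 ->
  m (horner_alg u f) -> exists x y, m ((u - x%:A) ^+ 2 + (y ^+ 2)%:A).
Proof.
move=> pm; have /prime_idealP[Im m1 mM] := pm.
have [n] := ubnP (size f); elim: n f => // n IHn f; rewrite ltnS => szf f0 mf.
have scal c : c != 0 -> ~ m (c%:A).
  move=> c0 mc; apply: m1; have -> : 1 = c^-1%:A * c%:A :> A.
    by rewrite -!in_algE -rmorphM mulVf // rmorph1.
  exact: ideal_setM.
have [sz1|sz1] := leqP (size f) 1.
  have := size1_polyC sz1 => fc; rewrite fc horner_algC in mf.
  by case: (scal f`_0) => //; rewrite -polyC_eq0 -fc.
have [[x y] zroot] : exists z : K[i], root (map_poly (real_complex K) f) z.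
  by apply/closed_rootP; rewrite size_map_poly neq_ltn sz1 orbT.
have [y0|y0] := eqVneq y 0.
  move: zroot; rewrite y0 -[(x +i* 0)%C]/(real_complex K x) fmorph_root.
  move=> /factor_theorem[g fE]; move: mf; rewrite fE rmorphM => /mM[mg|].
    apply: (IHn g) mg; last by move: f0; rewrite fE; apply: contra => /eqP->; rewrite mul0r.
    apply: leq_trans szf; rewrite fE size_Mmonic ?monicXsubC ?size_XsubC ?addn2 //.
    by move: f0; rewrite fE; apply: contra => /eqP->; rewrite mul0r.
  rewrite rmorphB /= horner_algX horner_algC => mux; exists x, 0.
  by rewrite expr0n scale0r addr0 expr2; apply: ideal_setM.
(* The quadratic factor with roots x + y i and x - y i: the remainder of f
   modulo Q has degree at most 1 and a root that is not real. *)
pose Q : {poly K} := ('X - x%:P) ^+ 2 + (y ^+ 2)%:P.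
have szQ : size Q = 3 by rewrite size_polyDl size_exp_XsubC // (leq_ltn_trans (size_polyC_leq1 _)).
have Q0 : Q != 0 by rewrite -size_poly_eq0 szQ.
have Qz : (map_poly (real_complex K) Q).[(x +i* y)%C] = 0.
  rewrite /Q rmorphD rmorphXn rmorphB /= map_polyX !map_polyC /= !hornerE.
  by apply/eqP; rewrite eq_complex /=; apply/andP; split; apply/eqP; ring.
pose r := f %% Q.
have szr : (size r <= 2)%N by have := ltn_modp f Q; rewrite Q0 szQ ltnS.
have rE : r = r`_1 *: 'X + (r`_0)%:P.
  apply/polyP=> -[|[|j]]; rewrite coefD coefZ coefX coefC /= ?mulr0 ?mulr1 ?addr0 ?add0r //.
  by apply: nth_default; exact: leq_trans szr _.
have : (map_poly (real_complex K) r).[(x +i* y)%C] = 0.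
  have := zroot; rewrite {1}(divp_eq f Q) rmorphD rmorphM /= rootE hornerD hornerM Qz.
  by rewrite mulr0 add0r => /eqP.
rewrite rE rmorphD /= map_polyZ map_polyX map_polyC /= !hornerE.
move=> /eqP; rewrite eq_complex /= => /andP[/eqP re /eqP im].
have r1 : r`_1 = 0.
  by apply/eqP; move/eqP: im; rewrite mul0r !addr0 mulf_eq0 (negbTE y0) orbF.
have r0 : r`_0 = 0 by move: re; rewrite r1 !mul0r subr0 add0r.
have fE : f = f %/ Q * Q by rewrite {1}(divp_eq f Q) -/r rE r1 r0 scale0r !addr0.
have g0 : f %/ Q != 0 by move: f0; rewrite {1}fE; apply: contra => /eqP->; rewrite mul0r.
move: mf; rewrite fE rmorphM => /mM[mg|].
  apply: (IHn (f %/ Q)) mg => //; rewrite size_divp // szQ.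
  by apply: leq_trans szf; rewrite ltn_subrL (ltn_trans _ sz1).
rewrite rmorphD rmorphXn rmorphB /= horner_algX !horner_algC => mQ.
by exists x, y.
Qed.

(** A non-real element w of the residue field gives a square root of -1, hence
    a copy of the complex numbers, given by psi modulo m. Every u is congruent to
    an element of this copy, where roots exist. *)
Lemma residue_power m k u : maximal_ideal m ->
  (forall u, exists2 f : {poly K}, f != 0 & m (horner_alg u f)) ->
  ~ real_maximal_ideal m -> (0 < k)%N -> exists b, m (b ^+ k - u).
Proof.
move=> mm alg nreal k0; have pm := maximal_prime mm.
have /prime_idealP[Im m1 mM] := pm.
have [w wP] : exists w, forall x : K, ~ m (w - x%:A).
  apply: contrapT => H; apply: nreal; apply: real_maximal_residue => // w.
  by apply: contrapT => Hw; apply: H; exists w => x mx; apply: Hw; exists x.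
(* The residue field contains a square root i of -1. *)
have [i mi] : exists i, m (i ^+ 2 + 1).
  have [f f0 mf] := alg w; have [x [y mxy]] := conjugate_roots pm f0 mf.
  have y0 : y != 0.
    apply/eqP => y0; apply: (wP x); apply: (prime_idealX (n := 2)) => //.
    by move: mxy; rewrite y0 expr0n scale0r addr0.
  exists (y^-1 *: (w - x%:A)).
  have -> : (y^-1 *: (w - x%:A)) ^+ 2 + 1 =
      (y ^- 2)%:A * ((w - x%:A) ^+ 2 + (y ^+ 2)%:A).
    rewrite mulrDr exprZn exprVn mulr_algl; congr (_ + _).
    by rewrite mulr_algl scalerA mulVf ?scale1r // expf_neq0.
  exact: ideal_setM.
pose psi z : A := (complex.Re z)%:A + (complex.Im z)%:A * i.
have psiM z z' : m (psi (z * z') - psi z * psi z').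
  case: z z' => [a b] [c d].
  have -> : psi ((a +i* b)%C * (c +i* d)%C) - psi (a +i* b)%C * psi (c +i* d)%C =
      - (b * d)%:A * (i ^+ 2 + 1).
    by rewrite /psi /= -!in_algE !(rmorphD, rmorphN, rmorphM); ring.
  exact: ideal_setM.
have psiX z n : m (psi z ^+ n - psi (z ^+ n)).
  elim: n => [|n IHn].
    by rewrite !expr0 /psi /= scale0r mul0r addr0 scale1r subrr; case: Im.
  rewrite !exprS.
  have -> : psi z * psi z ^+ n - psi (z * z ^+ n) =
    psi z * (psi z ^+ n - psi (z ^+ n)) - (psi (z * z ^+ n) - psi z * psi (z ^+ n)) by ring.
  by apply: ideal_setB => //; apply: ideal_setM.
have psi_root z : m (u - psi z) -> exists b, m (b ^+ k - u).
  move=> muz; exists (psi (k.-root z)).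
  have -> : psi (k.-root z) ^+ k - u =
    (psi (k.-root z) ^+ k - psi (k.-root z ^+ k)) - (u - psi z) by rewrite rootCK //; ring.
  exact: ideal_setB.
have [f f0 mf] := alg u; have [x [y mxy]] := conjugate_roots pm f0 mf.
have : m ((u - psi (x +i* y)%C) * (u - psi (x -i* y)%C)).
  have -> : (u - psi (x +i* y)%C) * (u - psi (x -i* y)%C) =
      (u - x%:A) ^+ 2 + (y ^+ 2)%:A - (y ^+ 2)%:A * (i ^+ 2 + 1).
    by rewrite /psi /= -!in_algE !(rmorphN, rmorphXn); ring.
  by apply: ideal_setB => //; apply: ideal_setM.
by move=> /mM[]; apply: psi_root.
Qed.
End ComplexResidueField.

Section Lifting.
Variable A : comNzRingType.
Hypotheses (noethA : noetherian A) (natA_unit : forall n, exists u : A, n.+1%:R * u = 1).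

Lemma exprD_mod_square (b s : A) n :
  exists r, (b + s) ^+ n.+1 = b ^+ n.+1 + n.+1%:R * b ^+ n * s + s ^+ 2 * r.
Proof.
elim: n => [|n [r E]]; first by exists 0; rewrite !expr1 expr0; ring.
exists (r * b + n.+1%:R * b ^+ n + s * r).
by rewrite exprS E -[n.+2%:R]natr1 !exprS; ring.
Qed.

(** An ideal J maximal among those over I modulo which u has no root is
    radical, since roots of units lift along nilpotents. In dimension zero an
    element x outside J is then a unit modulo J up to an idempotent; a proper
    idempotent would split J into two larger ideals, along which roots of u can
    be glued. So J is prime, where the hypothesis provides a root. *)
Lemma power_lift (I : set A) k u u' : ideal_set I ->
  (forall P Q, prime_ideal P -> prime_ideal Q -> I `<=` P -> P `<=` Q -> P = Q) ->
  (forall P, prime_ideal P -> I `<=` P -> exists b, P (b ^+ k.+1 - u)) ->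
  I (u * u' - 1) -> exists b, I (b ^+ k.+1 - u).
Proof.
move=> II dim0 res uu'; apply: contrapT => noroot.
pose F : set (set A) := [set J | [/\ ideal_set J, I `<=` J & ~ exists b, J (b ^+ k.+1 - u)]].
have [||J [IJ sIJ nJ] Jmax] := noetherian_maximal noethA (F := F).
- by move=> J [].
- by exists I; split.
have J1 : ~ J 1.
  by move=> J1; apply: nJ; exists 0; rewrite -[_ - _]mulr1; apply: ideal_setM.
have adj x : ~ J x -> exists b, ideal_adjoin J x (b ^+ k.+1 - u).
  move=> nJx; apply: contrapT => H; apply: nJx.
  rewrite -(Jmax (ideal_adjoin J x)); [exact: ideal_adjoin_mem | | exact: sub_ideal_adjoin].
  split=> //; first exact: ideal_adjoin_ideal.
  exact: subset_trans sIJ (@sub_ideal_adjoin _ _ _).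
have radical x : J (x ^+ 2) -> J x.
  move=> Jx2; apply: contrapT => /adj[b [y [a [Jy bE]]]]; apply: nJ.
  (* Newton's correction x t solves (k + 1) b^k t = - a modulo x, where
     b u' inverts b^k. *)
  have [v vE] := natA_unit k; pose t := - (a * v * (b * u')).
  have [r rE] := exprD_mod_square b (x * t) k; exists (b + x * t).
  have -> : (b + x * t) ^+ k.+1 - u =
      y - a * x * (u' * y) - a * x * (u * u' - 1) + x ^+ 2 * (t ^+ 2 * r - a ^+ 2 * u').
    have {}bE : b * b ^+ k = u + y + a * x by rewrite -exprS -[LHS](subrK u) bE; ring.
    have -> : (b + x * t) ^+ k.+1 - u = b * b ^+ k - u
        - (k.+1%:R * v) * (b * b ^+ k) * (a * x * u') + x ^+ 2 * (t ^+ 2 * r).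
      by rewrite rE exprS /t; ring.
    by rewrite bE vE; ring.
  apply: ideal_setD => //; last by rewrite mulrC; apply: ideal_setM.
  apply: ideal_setB => //; last by apply: ideal_setM => //; apply: sIJ.
  by apply: ideal_setB => //; rewrite mulrA; apply: ideal_setM.
have radicalX x n : J (x ^+ n) -> J x.
  move=> Jxn; have : J (x ^+ (2 ^ n)).
    rewrite -(subnK (ltnW (ltn_expl n (ltnSn 1)))) exprD.
    exact: ideal_setM.
  elim: n {Jxn} => [|n IHn]; first by rewrite expn0 expr1.
  by rewrite expnSr exprM => /radical.
(* The product of x and s lies in J, and dimension zero makes x and the ideal
   of all such s comaximal. *)
have inv x : ~ J x -> exists y, J (x * y - 1).
  move=> nJx; pose M : set A := [set z | exists p s, [/\ ideal_adjoin J x p, J (s * x) & z = p + s]].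
  have IM : ideal_set M.
    have Iad := ideal_adjoin_ideal x IJ.
    split; first by exists 0, 0; rewrite mul0r addr0; case: IJ Iad => J0 _ [].
    move=> c _ _ [p [s [Jp Js ->]]] [q [w [Jq Jw ->]]].
    exists (c * p + q), (c * s + w); split; [exact: Iad.2 | | ring].
    by rewrite mulrDl -mulrA; apply: (IJ.2).
  have [p [s [[y [a [Jy ->]]] Jsx E]]] : M 1.
    apply: (no_prime_ideal_above noethA IM) => P pP MP.
    have JP : J `<=` P.
      move=> z Jz; apply: MP; exists z, 0; rewrite mul0r addr0; split=> //.
        exact: sub_ideal_adjoin.
      by case: IJ.
    have Px : P x.
      apply: MP; exists x, 0; rewrite mul0r addr0; split=> //; last by case: IJ.
      exact: ideal_adjoin_mem.
    have /prime_idealP[_ P1 PM] := pP.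
    (* A prime that avoids S lies strictly below P, as it misses x. *)
    pose S : set A := [set z | exists w n, ~ P w /\ z = w * x ^+ n].
    have [||z [w [n [Pw ->]]] Jwx|Q [pQ JQ SQ]] := @prime_avoiding _ noethA J S IJ.
    - by exists 1, 0%N; rewrite expr0 mulr1.
    - move=> _ _ [w [n [Pw ->]]] [w' [n' [Pw' ->]]]; exists (w * w'), (n + n')%N.
      by split; [move=> /PM[] | rewrite exprD; ring].
    - apply: Pw; apply: MP; exists 0, w; rewrite add0r; split=> //.
        exact: (ideal_adjoin_ideal x IJ).1.
      apply: (radicalX _ n.+1); rewrite exprMn exprSr [x ^+ _]exprS.
      have -> : w ^+ n * w * (x * x ^+ n) = w ^+ n * x * (w * x ^+ n) by ring.
      exact: ideal_setM.
    have QP : Q `<=` P.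
      move=> z Qz; apply: contrapT => Pz; apply: (SQ z) => //.
      by exists z, 0%N; rewrite expr0 mulr1.
    apply: (SQ x); first by exists 1, 1%N; rewrite mul1r.
    by rewrite (dim0 Q P pQ pP) //; apply: subset_trans JQ.
  have [Js|nJs] := pselect (J s).
    exists a; have -> : x * a - 1 = - (y + s) by rewrite E; ring.
    by apply: ideal_setN => //; apply: ideal_setD.
  have [b1 xb1] := adj x nJx; have [b2 sb2] := adj s nJs.
  (* Glue the two roots along the partition 1 = a * x + s modulo J. *)
  pose b := b1 * s + b2 * (a * x).
  have congr L c : ideal_set L -> L (b - c) -> L (c ^+ k.+1 - u) -> L (b ^+ k.+1 - u).
    move=> IL Lbc Lc; have -> : b ^+ k.+1 - u = (b ^+ k.+1 - c ^+ k.+1) + (c ^+ k.+1 - u) by ring.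
    by apply: ideal_setD => //; rewrite subrXX mulrC; apply: ideal_setM.
  have [y1 [a1 [Jy1 E1]]] : ideal_adjoin J x (b ^+ k.+1 - u).
    apply: congr xb1; first exact: ideal_adjoin_ideal.
    exists (- (b1 * y)), ((b2 - b1) * a); split.
      by apply: ideal_setN => //; apply: ideal_setM.
    by rewrite /b -[X in _ - X]mulr1 E; ring.
  have [y2 [a2 [Jy2 E2]]] : ideal_adjoin J s (b ^+ k.+1 - u).
    apply: congr sb2; first exact: ideal_adjoin_ideal.
    exists (- (b2 * y)), (b1 - b2); split.
      by apply: ideal_setN => //; apply: ideal_setM.
    by rewrite /b -[X in _ - X]mulr1 E; ring.
  case: nJ; exists b; rewrite -[_ - u]mulr1 E mulrDr mulrDr.
  apply: ideal_setD => //; first apply: ideal_setD => //.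
  - exact: ideal_setM.
  - have -> : (b ^+ k.+1 - u) * (a * x) = a * x * y2 + (a * a2) * (s * x) by rewrite E2; ring.
    by apply: ideal_setD => //; apply: ideal_setM.
  - have -> : (b ^+ k.+1 - u) * s = s * y1 + a1 * (s * x) by rewrite E1; ring.
    by apply: ideal_setD => //; apply: ideal_setM.
have pJ : prime_ideal J.
  apply/prime_idealP; split=> // x y Jxy; apply: contrapT => /not_orP[nx ny].
  have [z Jz] := inv x nx; apply: ny.
  have -> : y = z * (x * y) - y * (x * z - 1) by ring.
  by apply: ideal_setB => //; apply: ideal_setM.
by apply: nJ; apply: res.
Qed.
End Lifting.

(** * Real affine algebras *)

Section RealAffineAlgebra.
Variables (K : realType) (R : comAlgType K).
Hypothesis fgR : finitely_generated_algebra R.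
Let noethR : noetherian R := noetherian_finitely_generated fgR.

Lemma natr_unit_alg n : exists u : R, n.+1%:R * u = 1.
Proof.
exists (n.+1%:R^-1)%:A; rewrite -(rmorph_nat (in_alg R)) -in_algE -rmorphM.
by rewrite mulfV ?pnatr_eq0 // rmorph1.
Qed.

Lemma poly_nonroot (f : {poly K}) : f != 0 -> exists x, f.[x] != 0.
Proof.
move=> f0; apply: contrapT => H.
have rf x : root f x by apply/eqP; apply: contrapT => /eqP fx; apply: H; exists x.
pose s : seq K := [seq i%:R | i <- iota 0 (size f)].
suff : (size s < size f)%N by rewrite size_map size_iota ltnn.
apply: max_poly_roots => //; first by apply/allP => x _.
by rewrite map_inj_uniq ?iota_uniq // => i j /eqP; rewrite eqr_nat => /eqP.
Qed.

Section ComplexPoints.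
Variable I : set R.
Hypothesis II : ideal_set I.
Hypothesis complexI : forall P, prime_ideal P -> I `<=` P ->
  maximal_ideal P /\ ~ real_maximal_ideal P.

Lemma unit_mod_power u k : unit_mod I u -> exists b, I (b ^+ k.+1 - u).
Proof.
move=> [u' uu']; apply: (power_lift noethR natr_unit_alg II _ _ uu').
  move=> P Q pP pQ IP PQ; have [[_ Pmax] _] := complexI pP IP.
  by rewrite (Pmax Q) //; case: pQ.
move=> P pP IP; have [mP nrP] := complexI pP IP.
by apply: residue_power => // w; apply: residue_algebraic.
Qed.

(** Otherwise some prime over I avoids all the values of nonzero polynomials
    at x, against residue_algebraic. *)
Lemma algebraic_mod x : exists2 f : {poly K}, f != 0 & I (horner_alg x f).
Proof.
apply: contrapT => transc.
pose S : set R := [set horner_alg x f | f in [set f : {poly K} | f != 0]].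
have [||_ [f f0 <-] If|P [pP IP SP]] := @prime_avoiding _ noethR I S II.
- by exists 1; [exact: oner_neq0 | rewrite rmorph1].
- move=> _ _ [f f0 <-] [g g0 <-]; exists (f * g); last by rewrite rmorphM.
  by rewrite /= mulf_neq0.
- by apply: transc; exists f.
have [mP _] := complexI pP IP.
have [f f0 Pf] := residue_algebraic fgR x mP.
by apply: (SP (horner_alg x f)) => //; exists f.
Qed.

(** Divide f by X + c: the remainder f(- c) is a nonzero scalar. *)
Lemma unit_mod_shift x (f : {poly K}) (c : K) :
  I (horner_alg x f) -> f.[- c] != 0 -> unit_mod I (x + c%:A).
Proof.
move=> If fc; have : root (f - (f.[- c])%:P) (- c).
  by rewrite rootE hornerD hornerN hornerC subrr.
move=> /factor_theorem[g gE]; exists ((- (f.[- c])^-1)%:A * horner_alg x g).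
have : horner_alg x (f - (f.[- c])%:P) = horner_alg x (g * ('X - (- c)%:P)) by rewrite gE.
rewrite rmorphB rmorphM rmorphB /= horner_algX !horner_algC => E.
have fE : horner_alg x f = horner_alg x g * (x + c%:A) + (f.[- c])%:A.
  by rewrite -[LHS](subrK ((f.[- c])%:A)) E scaleNr opprK.
have ss : (f.[- c])^-1%:A * (f.[- c])%:A = 1 :> R.
  by rewrite -!in_algE -rmorphM mulVf // rmorph1.
have -> : (x + c%:A) * ((- (f.[- c])^-1)%:A * horner_alg x g) - 1 =
    - (f.[- c])^-1%:A * horner_alg x f.
  by rewrite fE -[X in _ - X]ss scaleNr; ring.
exact: ideal_setM.
Qed.

Lemma unit_mod_congr x y : I (x - y) -> unit_mod I x -> unit_mod I y.
Proof.
move=> Ixy [z Iz]; exists z; have -> : y * z - 1 = (x * z - 1) - z * (x - y) by ring.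
by apply: ideal_setB => //; apply: ideal_setM.
Qed.

Lemma unit_modM x y : unit_mod I x -> unit_mod I y -> unit_mod I (x * y).
Proof.
move=> [x' Ix] [y' Iy]; exists (x' * y').
have -> : x * y * (x' * y') - 1 = (y * y') * (x * x' - 1) + (y * y' - 1) by ring.
by apply: ideal_setD => //; apply: ideal_setM.
Qed.

(** Each of the three conditions excludes finitely many scalars, the opposites
    of roots of a polynomial that annihilates an element modulo I. *)
Lemma generic_scalar x y : unit_mod I x -> unit_mod I y -> exists u u', [/\ u * u' = 1,
  unit_mod I (x + u), unit_mod I (x * u + y) & unit_mod I (x * y + u)].
Proof.
move=> Ix Iy; have [x' Ix'] := Ix.
have [f1 f10 If1] := algebraic_mod x; have [f2 f20 If2] := algebraic_mod (x' * y).
have [f3 f30 If3] := algebraic_mod (x * y).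
have [c] : exists c, ((f1 * f2) * (f3 * 'X)).[c] != 0.
  by apply: poly_nonroot; rewrite !mulf_neq0 ?polyX_eq0.
rewrite !hornerM hornerX !mulf_eq0 !negb_or -!andbA => /and4P[c1 c2 c3 c0].
have shift z f : I (horner_alg z f) -> f.[c] != 0 -> unit_mod I (z + (- c)%:A).
  by move=> If fc; apply: unit_mod_shift If _; rewrite opprK.
exists (- c)%:A, (- c)^-1%:A; split.
- by rewrite -!in_algE -rmorphM mulfV ?oppr_eq0 // rmorph1.
- exact: shift If1 c1.
- apply: unit_mod_congr (unit_modM Ix (shift _ _ If2 c2)).
  have -> : x * (x' * y + (- c)%:A) - (x * (- c)%:A + y) = y * (x * x' - 1) by ring.
  exact: ideal_setM.
- exact: shift If3 c3.
Qed.

End ComplexPoints.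

Section Dimension.
Variable d : nat.
Hypothesis dimR : krull_dim K R = (d%:R : K)%:E.
Let realpoints : set R := \bigcap_(m in real_maximal_ideal (A := R)) m.
Hypothesis real_height : ~ (exists m : set R, real_maximal_ideal m) \/
  (1%:E <= height K realpoints)%E.

Lemma no_long_chain (c : nat -> set R) : ~ prime_chain d.+1 c.
Proof.
move=> cc; have : ((d.+1%:R : K)%:E <= krull_dim K R)%E.
  by apply: ereal_sup_ubound; exists d.+1 => //; exists c.
by rewrite dimR lee_fin ler_nat ltnn.
Qed.

Lemma dim_lt_ring a : dim_lt a (set0 : set R) (d + 1).
Proof. by move=> c; rewrite addn1 => /no_long_chain. Qed.

(** Without real points the real locus is empty, since the intersection is then
    the whole ring. Otherwise a prime over the intersection has positive height,
    so a chain that starts there extends downwards. *)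
Lemma dim_lt_real a : dim_lt a realpoints d.
Proof.
move=> c cc Jc; have pc0 : prime_ideal (c 0%N) by apply: cc.1.
have [nreal|ht] := real_height.
  case: (prime_ideal1 pc0); apply: Jc => m mreal.
  by case: nreal; exists m.
have {}ht : (1%:E <= prime_height K (c 0%N))%E.
  by apply: le_trans ht (ereal_inf_lbound _); exists (c 0%N).
have [n [b [bb bn]]] : exists n, exists b : nat -> set R,
    prime_chain n.+1 b /\ b n.+1 = c 0%N.
  apply: contrapT => H; suff : (prime_height K (c 0%N) <= 0)%E.
    by move=> /(le_trans ht); rewrite lee_fin ler10.
  apply: ge_ereal_sup => _ [[|n] [b [cb bn]] <-]; first by rewrite lexx.
  by case: H; exists n, b.
case: (@no_long_chain (fun i => if i is j.+1 then c j else b n)).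
apply: prime_chain_extend => //; first by apply: bb.1.
by rewrite -bn; apply: bb.2.
Qed.

Lemma maximal_chain (P : set R) : prime_ideal P ->
  (forall Q, prime_ideal Q -> P `<` Q -> False) -> maximal_ideal P.
Proof.
move=> pP Pmax; split; first by case: pP.
move=> J /proper_ideal_setP[IJ J1] PJ; have [Q pQ JQ] := prime_ideal_above noethR IJ J1.
apply/seteqP; split=> // x Jx; apply: contrapT => Px.
apply: (Pmax Q pQ); split; first exact: subset_trans PJ JQ.
by move=> /(_ x (JQ x Jx)).
Qed.

(** After d steps of general position the primes over w that miss a admit no
    inclusion, and none of them lies over the real locus; by unimodularity all
    primes over w miss a. *)
Lemma general_position_row a (v : 'rV[R]_d) : unimodular (row_cons a v) ->
  exists2 w, elementary_equiv (row_cons a v) (row_cons a w) &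
  forall P, prime_ideal P -> row_ideal w `<=` P ->
    maximal_ideal P /\ ~ real_maximal_ideal P.
Proof.
move=> Uav; pose b i : R := if insub i is Some j then v 0 j else 0.
have dimJ : dim_lt a realpoints (d + 0) by rewrite addn0; apply: dim_lt_real.
have [c [cb cR cJ]] := general_position noethR natr_unit_alg b (dim_lt_ring a) dimJ.
have [u uE] : {u : nat -> R | forall i, c i = b i + u i * a}.
  by exists (fun i => sval (cid (cb i))) => i; case: cid.
pose w := v + a *: (\row_j u j); have wE j : w 0 j = c j.
  by rewrite !mxE uE /b valK mulrC.
have eqw : elementary_equiv (row_cons a v) (row_cons a w) by exact: elementary_equiv_tail.
exists w => // P pP wP.
have IP := prime_ideal_ideal pP.
have Pc : [set c i | i in `I_d] `<=` P.
  move=> _ [i lid <-]; rewrite -(wE (Ordinal lid)); apply: wP.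
  exact: row_ideal_entry.
have noa Q : prime_ideal Q -> P `<=` Q -> ~ Q a.
  move=> pQ PQ Qa; apply: (prime_ideal1 pQ); have IQ := prime_ideal_ideal pQ.
  have /unimodularE/row_ideal_cons[x [y [wy ->]]] := (unimodular_elementary eqw).1 Uav.
  apply: ideal_setD => //; last by apply: PQ; apply: wP.
  by rewrite mulrC; apply: ideal_setM.
split.
  apply: maximal_chain => // Q pQ PQ; apply: (noa Q pQ (properW PQ)).
  apply: (cR (fun i => if i is _.+1 then Q else P)).
    by split=> [[|i]|[|i]].
  by move=> x [//|/Pc].
move=> Preal; apply: (noa P pP (@subset_refl _ _)).
apply: (cJ (fun=> P)); first by split.
by move=> x [/(_ P Preal)|/Pc].
Qed.

(** Put v in general position first; its zeros are then closed points. Where b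
    vanishes some entry of w does not, and the other zeros of v are avoided by
    one generic entry of w. *)
Lemma general_position_comaximal a b (v w : 'rV[R]_d) : (0 < d)%N ->
  unimodular (row_cons a v) -> unimodular (row_cons b w) ->
  exists v' w', [/\ elementary_equiv (row_cons a v) (row_cons a v'),
    elementary_equiv (row_cons b w) (row_cons b w') &
    exists p q, [/\ row_ideal v' p, row_ideal w' q & p + q = 1]].
Proof.
move=> d0 Uv Uw; have [v' eqv v'P] := general_position_row Uv.
pose i0 := Ordinal d0.
(* The zeros of v' are closed points, so one entry of w' already avoids those
   at which b is invertible. *)
have dimv : dim_lt b (row_ideal v') 1.
  move=> c [cp cS] vc; have [[_ cmax] _] := v'P _ (cp 0%N isT) vc.
  have := cS 0%N isT => -[c01 c10]; case: c10.
  by rewrite (cmax (c 1%N)) //; case: (cp 1%N isT).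
have [c [cb cv _]] := @general_position _ noethR natr_unit_alg b
  (fun=> w 0 i0) (row_ideal v') (row_ideal v') 0 0 1 dimv dimv.
have [u uE] := cb 0%N.
pose w' := w + b *: (u *: delta_mx 0 i0).
have w'E : w' 0 i0 = c 0%N by rewrite !mxE !eqxx mulr1 uE mulrC.
have eqw : elementary_equiv (row_cons b w) (row_cons b w') by exact: elementary_equiv_tail.
exists v', w'; split=> //.
pose M : set R := [set z | exists p q, [/\ row_ideal v' p, row_ideal w' q & z = p + q]].
suff [p [q [vp wq E]]] : M 1 by exists p, q.
apply: (no_prime_ideal_above noethR) => [|P pP MP].
  split; first by exists 0, 0; rewrite addr0; split=> //; apply: row_ideal0.
  move=> t _ _ [p [q [vp wq ->]]] [p' [q' [vp' wq' ->]]].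
  exists (t * p + p'), (t * q + q'); split; [exact: row_idealD | exact: row_idealD | ring].
have vP : row_ideal v' `<=` P.
  by move=> x vx; apply: MP; exists x, 0; rewrite addr0; split=> //; apply: row_ideal0.
have wP : row_ideal w' `<=` P.
  by move=> x wx; apply: MP; exists 0, x; rewrite add0r; split=> //; apply: row_ideal0.
have Pb : P b.
  apply: (cv (fun=> P)); first by split.
  move=> x [/vP//|[j]]; rewrite /= ltnS leqn0 => /eqP-> <-.
  by rewrite -w'E; apply: wP; apply: row_ideal_entry.
have IP := prime_ideal_ideal pP; apply: (prime_ideal1 pP).
have /unimodularE/row_ideal_cons[x [y [wy ->]]] := (unimodular_elementary eqw).1 Uw.
apply: ideal_setD => //; last exact: wP.
by rewrite mulrC; apply: ideal_setM.
Qed.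

End Dimension.
End RealAffineAlgebra.

Theorem corollary4p3 (K : realType) (R : comAlgType K) (d : nat)
    (hR : finitely_generated_algebra R)
    (hdim : krull_dim K R = (d%:R : K)%:E) (hd : (2 <= d)%N)
    (hreal : ~ (exists m : set R, real_maximal_ideal m) \/
             (1%:E <= height K (\bigcap_(m in real_maximal_ideal (A := R)) m))%E)
    (G : groupType) (phi : Um R d.+1 -> G)
    (hphi : universal_weak_mennicke_symbol phi) :
  divisible_group G.
Proof.
have [phiW _] := hphi; have FW := total_symbol_map phiW; have [FE _] := FW.
apply: (universal_divisible hphi).
  apply: (universal_commutative hphi) => u w; rewrite -!total_symbolE.
  case: u w => [u Uu] [w Uw] /=.
  have [a [u1 uE]] := row_cons_eta u; have [b [w1 wE]] := row_cons_eta w.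
  move: Uu Uw; rewrite {}uE {}wE => Uu Uw.
  have [|u2 [w2 [eu ew [p [q [up wq pq]]]]]] :=
    general_position_comaximal hR hdim hreal _ Uu Uw; first exact: ltnW.
  rewrite (FE _ _ eu) (FE _ _ ew); apply: map_commute up wq pq => //.
    exact/(unimodular_elementary eu).
  exact/(unimodular_elementary ew).
move=> [//|k] u _; rewrite -total_symbolE.
case: u => u Uu /=; have [a [u1 uE]] := row_cons_eta u.
move: Uu; rewrite {}uE => Uu.
have [v ev vP] := general_position_row hR hdim hreal Uu.
have Iv : ideal_set (row_ideal v) by split; [exact: row_ideal0 | exact: row_idealD].
have va : unit_mod (row_ideal v) a.
  have /unimodularE/row_ideal_cons[x [y [vy E]]] := (unimodular_elementary ev).1 Uu.
  by exists x; rewrite E opprD addrA subrr sub0r; apply: row_idealN.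
have [b vb] := unit_mod_power hR Iv vP k va.
exists (total_symbol phi (row_cons b v)).
have bu : unit_mod (row_ideal v) b.
  have [x vx] := va; exists (b ^+ k * x).
  rewrite mulrA -exprS; have -> : b ^+ k.+1 * x - 1 = x * (b ^+ k.+1 - a) + (a * x - 1) by ring.
  by apply: ideal_setD => //; apply: ideal_setM.
rewrite (FE _ _ ev) (FE (row_cons a v) (row_cons (b ^+ k.+1) v)); last first.
  exact: elementary_equiv_head.
have sqr x : unit_mod (row_ideal v) x -> exists z, row_ideal v (z ^+ 2 - x).
  exact: unit_mod_power.
have gen := generic_scalar hR Iv vP.
have F1 := total_symbol1 phiW.
have [m dE] : exists m, d = m.+2 by case: (d) hd => [|[|m]] // _; exists m.
move: (total_symbol phi) v {ev vP} Iv va vb bu sqr gen FW FE F1.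
rewrite dE => F v Iv va vb bu sqr gen FW FE F1.
have [v0 [v' vE]] := row_cons_eta v; have [v1 [r v'E]] := row_cons_eta v'.
rewrite {}v'E in vE; rewrite {}vE in Iv va vb bu sqr gen *.
by symmetry; apply: map_exp.
Qed.
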